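(* Let $n\ge1$ and let $G_n(\lambda)=G(\lambda_1,\dots,\lambda_n)$ be the oscillator group with structure constants satisfying $\lambda_i=\lambda_j$ for all $i,j=1,\dots,n$, with its left-invariant metric $g$ for which the canonical frame is orthonormal. Then each left-invariant unit vector field $V$ on $G_n(\lambda)$ that defines a harmonic map $V:(G_n(\lambda),g)\to(T_1G_n(\lambda),g_S)$ into the unit tangent bundle with the Sasaki metric is minimal.
   Context: Oscillator group: for real numbers $\lambda_1,\dots,\lambda_n$, $G_n(\lambda)$ is the connected simply connected solvable Lie group whose Lie algebra has basis $e_1,\dots,e_n,e_{n+1},\dots,e_{2n},e_{2n+1}=\xi,e_{2n+2}=\zeta$ (the canonical frame) with non-vanishing brackets $[e_i,e_{n+j}]=\delta_{ij}\xi$, $[\zeta,e_j]=\lambda_je_{n+j}$, $[\zeta,e_{n+j}]=-\lambda_je_j$ ($1\le i,j\le n$). It carries the left-invariant Riemannian metric $g$ making the canonical frame (viewed as left-invariant vector fields) orthonormal. For a Riemannian manifold $(M,g)$ with Levi-Civita connection $\nabla$, the Sasaki metric $g_S$ on $TM$ has line element $d\sigma^2=ds^2+|DV|_g^2$, where $DV^i=dV^i+\Gamma^i_{jk}V^jdu^k$ in natural local coordinates $(u^i;V^i)$; the unit tangent bundle $T_1M\subset TM$ carries the induced metric, also denoted $g_S$. A unit vector field $V$ on $M$ is an embedding $V:M\to T_1M$. Minimal: $V$ is minimal if the submanifold $V(M)\subset(T_1M,g_S)$ has zero mean curvature vector. Harmonic map: put $A_VX=-\nabla_XV$ and $(\nabla_XA_V)Y=\nabla_X(A_VY)-A_V(\nabla_XY)$,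 and let $R$ be the curvature tensor of $(M,g)$. The unit field $V$ defines a harmonic map $V:(M,g)\to(T_1M,g_S)$ if, for a local orthonormal frame $\{E_i\}$, $\sum_i(\nabla_{E_i}A_V)E_i=|A_V|^2V$ and $\sum_iR(V,A_VE_i)E_i=0$ (i.e. the tension field of this map vanishes). *)

(* Defs.v *)
From HB Require Import structures.
From mathcomp Require Import all_boot all_order all_algebra.
From mathcomp Require Import all_classical all_reals all_analysis.
From mathcomp Require Import ring lra.
Import Order.TTheory GRing.Theory Num.Theory.
Import numFieldNormedType.Exports.

Set Implicit Arguments.
Unset Strict Implicit.
Unset Printing Implicit Defensive.

Local Open Scope classical_set_scope.
Local Open Scope ring_scope.

(* Riemannian manifolds are given in one global chart: the manifold is R^N, a
   tangent vector is the row of its N coordinates with respect to the coordinate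
   fields, and a metric g assigns to x the matrix g x = (g_ij(x)). *)
Section Riemannian.
Variables (R : realType) (N : nat).
Implicit Types (g : 'rV[R]_N -> 'M[R]_N) (X Y Z : 'rV[R]_N -> 'rV[R]_N)
  (x u v w : 'rV[R]_N).

Definition basis_vec (i : 'I_N) : 'rV[R]_N := delta_mx 0 i.

Definition partial (i : 'I_N) (f : 'rV[R]_N -> R) x : R :=
  'D_(basis_vec i) f x.

Definition form_eval (A : 'M[R]_N) u v : R := (u *m A *m v^T) 0 0.

Definition christoffel g (k i j : 'I_N) x : R :=
  2^-1 * \sum_(l < N) invmx (g x) k l *
    (partial i (fun y => g y j l) x + partial j (fun y => g y i l) x
     - partial l (fun y => g y i j) x).

Definition christoffel_form g x u v : 'rV[R]_N :=
  \row_k \sum_(i < N) \sum_(j < N) christoffel g k i j x * u 0 i * v 0 j.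

Definition nabla g X Y : 'rV[R]_N -> 'rV[R]_N :=
  fun x => 'D_(X x) Y x + christoffel_form g x (X x) (Y x).

Definition lie_bracket X Y : 'rV[R]_N -> 'rV[R]_N :=
  fun x => 'D_(X x) Y x - 'D_(Y x) X x.

Definition curvature g X Y Z : 'rV[R]_N -> 'rV[R]_N :=
  fun x => nabla g X (nabla g Y Z) x - nabla g Y (nabla g X Z) x
           - nabla g (lie_bracket X Y) Z x.

Definition unit_field g V := forall x, form_eval (g x) (V x) (V x) = 1.

Definition orthonormal_frame g (E : 'I_N -> 'rV[R]_N -> 'rV[R]_N) :=
  forall x i j, form_eval (g x) (E i x) (E j x) = (i == j)%:R.

Definition shape_op g V X : 'rV[R]_N -> 'rV[R]_N :=
  fun x => - nabla g X V x.

Definition nabla_shape_op g V X Y : 'rV[R]_N -> 'rV[R]_N :=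
  fun x => nabla g X (shape_op g V Y) x - shape_op g V (nabla g X Y) x.

Definition shape_op_norm2 g (E : 'I_N -> 'rV[R]_N -> 'rV[R]_N) V x : R :=
  \sum_(i < N)
    form_eval (g x) (shape_op g V (E i) x) (shape_op g V (E i) x).

(* All the sums over i are traces with respect to g, so the choice of the
   orthonormal frame E is immaterial. *)
Definition defines_harmonic_map g (E : 'I_N -> 'rV[R]_N -> 'rV[R]_N) V :=
  [/\ orthonormal_frame g E,
      forall x, \sum_(i < N) nabla_shape_op g V (E i) (E i) x
                = shape_op_norm2 g E V x *: V x
    & forall x, \sum_(i < N) curvature g V (shape_op g V (E i)) (E i) x = 0].

(* A point of the tangent bundle is (u ; V) = row_mx u V, and a tangent vector
   at it is (du ; dV).  DV^i = dV^i + Gamma^i_jk V^j du^k, and the metric is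
   the polarization of ds^2 + |DV|^2. *)
Definition sasaki_D g (q w : 'rV[R]_(N + N)) : 'rV[R]_N :=
  rsubmx w + christoffel_form g (lsubmx q) (rsubmx q) (lsubmx w).

Definition sasaki_form g (q w w' : 'rV[R]_(N + N)) : R :=
  form_eval (g (lsubmx q)) (lsubmx w) (lsubmx w')
  + form_eval (g (lsubmx q)) (sasaki_D g q w) (sasaki_D g q w').

Definition sasaki_metric g (q : 'rV[R]_(N + N)) : 'M[R]_(N + N) :=
  \matrix_(a, b) sasaki_form g q (delta_mx 0 a) (delta_mx 0 b).

Definition sq_norm g (q : 'rV[R]_(N + N)) : R :=
  form_eval (g (lsubmx q)) (rsubmx q) (rsubmx q).

Definition section_map V x : 'rV[R]_(N + N) := row_mx x (V x).

End Riemannian.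

(* Mean curvature vector of an immersion F of R^N into the Riemannian
   hypersurface {phi = const} (with the induced metric) of (R^P, G).  The
   connection of the hypersurface is the component, tangent to it, of the
   Levi-Civita connection of G. *)
Section MeanCurvature.
Variables (R : realType) (N P : nat).
Variables (G : 'rV[R]_P -> 'M[R]_P) (phi : 'rV[R]_P -> R).
Variable F : 'rV[R]_N -> 'rV[R]_P.
Implicit Types (x : 'rV[R]_N) (p w : 'rV[R]_P).

Definition grad p : 'rV[R]_P :=
  (\row_a partial a phi p) *m invmx (G p).

Definition hypersurface_proj p w : 'rV[R]_P :=
  w - (form_eval (G p) w (grad p) / form_eval (G p) (grad p) (grad p))
      *: grad p.

Definition push (i : 'I_N) x : 'rV[R]_P := 'D_(basis_vec R i) F x.

Definition induced_metric x : 'M[R]_N :=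
  \matrix_(i, j) form_eval (G (F x)) (push i x) (push j x).

Definition nabla_along (i j : 'I_N) x : 'rV[R]_P :=
  'D_(basis_vec R i) (push j) x
  + christoffel_form G (F x) (push i x) (push j x).

Definition normal_proj x w : 'rV[R]_P :=
  w - \sum_(i < N) \sum_(j < N)
        (invmx (induced_metric x) i j * form_eval (G (F x)) w (push j x))
        *: push i x.

Definition second_fundamental_form (i j : 'I_N) x : 'rV[R]_P :=
  normal_proj x (hypersurface_proj (F x) (nabla_along i j x)).

Definition mean_curvature_vector x : 'rV[R]_P :=
  N%:R^-1 *: \sum_(i < N) \sum_(j < N)
    invmx (induced_metric x) i j *: second_fundamental_form i j x.

End MeanCurvature.

(* T_1M is the level set {sq_norm g = 1} of TM. *)
Definition minimal_field (R : realType) (N : nat) (g : 'rV[R]_N -> 'M[R]_N)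
    (V : 'rV[R]_N -> 'rV[R]_N) : Prop :=
  forall x, mean_curvature_vector (sasaki_metric g) (sq_norm g)
              (section_map V) x = 0.

(* Model of the simply connected group: R^(2n+2) with coordinates (p, z, t),
   p = (x_1..x_n, y_1..y_n) identified with x + i y in C^n, and
     (p, z, t) (p', z', t') =
       (p + e^(i lambda t) p', z + z' + omega(p, e^(i lambda t) p') / 2, t + t'),
   i.e. the Heisenberg group extended by the line t.  The group axioms are
   osc_mulA, osc_mul0l and osc_mulV, and the brackets of the canonical frame
   are the lemmas bracket_* below. *)
Section Oscillator.
Variables (R : realType) (n : nat) (lambda : 'I_n -> R).

Definition ord_e (i : 'I_n) : 'I_(n + n + 2) := lshift 2 (lshift n i).
Definition ord_f (i : 'I_n) : 'I_(n + n + 2) := lshift 2 (rshift n i).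
Definition ord_xi : 'I_(n + n + 2) := rshift (n + n) ord0.
Definition ord_zeta : 'I_(n + n + 2) := rshift (n + n) ord_max.

Definition osc_point (p : 'rV[R]_(n + n)) (z t : R) : 'rV[R]_(n + n + 2) :=
  row_mx p (\row_(j < 2) if j == ord0 then z else t).

Definition osc_rot (t : R) (p : 'rV[R]_(n + n)) : 'rV[R]_(n + n) :=
  row_mx
    (\row_i (cos (lambda i * t) * p 0 (lshift n i)
             - sin (lambda i * t) * p 0 (rshift n i)))
    (\row_i (sin (lambda i * t) * p 0 (lshift n i)
             + cos (lambda i * t) * p 0 (rshift n i))).

Definition osc_omega (p q : 'rV[R]_(n + n)) : R :=
  \sum_(i < n) (p 0 (lshift n i) * q 0 (rshift n i)
                - p 0 (rshift n i) * q 0 (lshift n i)).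

Definition osc_mul (a b : 'rV[R]_(n + n + 2)) : 'rV[R]_(n + n + 2) :=
  let q := osc_rot (a 0 ord_zeta) (lsubmx b) in
  osc_point (lsubmx a + q)
    (a 0 ord_xi + b 0 ord_xi + 2^-1 * osc_omega (lsubmx a) q)
    (a 0 ord_zeta + b 0 ord_zeta).

Definition left_invariant (X : 'rV[R]_(n + n + 2) -> 'rV[R]_(n + n + 2)) :=
  forall a x, 'D_(X x) (osc_mul a) x = X (osc_mul a x).

(* The left-invariant field whose value at the unit element 0 is the k-th
   vector of the standard basis. *)
Definition canonical_frame (k : 'I_(n + n + 2)) :
    'rV[R]_(n + n + 2) -> 'rV[R]_(n + n + 2) :=
  fun x => 'D_(basis_vec R k) (osc_mul x) 0.

Definition canonical_frame_mx x : 'M[R]_(n + n + 2) :=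
  \matrix_(k < n + n + 2) canonical_frame k x.

(* v *m invmx (canonical_frame_mx x) is the row of the components of v in the
   canonical frame at x. *)
Definition osc_metric x : 'M[R]_(n + n + 2) :=
  invmx (canonical_frame_mx x) *m (invmx (canonical_frame_mx x))^T.

End Oscillator.

Section DeriveFacts.
Variables (R : realType) (m : nat).
Implicit Types x v : 'rV[R]_m.

Lemma is_derive_row (k : nat) (f : 'rV[R]_m -> 'rV[R]_k) (df : 'rV[R]_k) x v :
  (forall j, is_derive x v (fun y => f y 0 j) (df 0 j)) -> is_derive x v f df.
Proof.
move=> h; have fd : derivable f x v.
  by apply/derivable_mxP => i j; rewrite (ord1 i); case: (h j).
apply: DeriveDef => //; rewrite derive_mx //.
by apply/rowP => j; rewrite mxE; case: (h j).
Qed.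

Lemma is_derive_coord x v (j : 'I_m) :
  is_derive x v (fun y : 'rV[R]_m => y 0 j) (v 0 j).
Proof.
have d : differentiable (fun y : 'rV[R]_m => y 0 j : R) x.
  exact: differentiable_coord.
apply: DeriveDef; first exact: diff_derivable.
rewrite /derive; apply: cvg_lim => //; apply: cvg_near_cst.
near=> h.
have h0 : h != 0 by near: h; exact: nbhs_dnbhs_neq.
by rewrite /= !mxE addrK /GRing.scale /= mulrA mulVf ?mul1r.
Unshelve. all: by end_near. Qed.

Lemma derive_line (f : 'rV[R]_m -> R) x v :
  'D_1 (fun h : R => f (h *: v + x)) 0 = 'D_v f x.
Proof.
rewrite /derive; set g1 := fun h => h^-1 *: _; set g2 := fun h => h^-1 *: _.
suff -> : g1 = g2 by [].
by apply/funext => h; rewrite /g1 /g2 /= addr0 scale0r add0r [_%:A]mulr1.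
Qed.

Lemma is_derive_compR (phi : R -> R) (f : 'rV[R]_m -> R) x v (a b : R) :
  is_derive (f x) 1 phi a -> is_derive x v f b ->
  is_derive x v (phi \o f) (a * b).
Proof.
move=> hp [fd fb]; pose l := fun h : R => f (h *: v + x).
have hp' : is_derive (l 0) 1 phi a by rewrite /l scale0r add0r.
have dl : is_derive (0 : R) 1 l b.
  by apply: DeriveDef; [move/derivable1P: fd|rewrite derive_line].
have [cd cb] : is_derive (0 : R) 1 (phi \o l) (a * b).
  exact: is_derive1_comp.
apply: DeriveDef; first exact/derivable1P.
by rewrite -derive_line.
Qed.

End DeriveFacts.

Section OscillatorFacts.
Variables (R : realType) (n : nat) (lambda : 'I_n -> R).
Local Notation point := ('rV[R]_(n + n + 2)).
Local Notation frame := (canonical_frame lambda).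
Implicit Types (a b c x u v : point) (p q : 'rV[R]_(n + n)).

Lemma osc_ordP (P : 'I_(n + n + 2) -> Prop) :
  (forall i, P (ord_e i)) -> (forall i, P (ord_f i)) ->
  P (ord_xi n) -> P (ord_zeta n) -> forall k, P k.
Proof.
move=> he hf hx hz k; case: (split_ordP k) => j ->.
  by case: (split_ordP j) => i ->; [exact: he|exact: hf].
case: (unliftP ord_max j) => [i|] -> //; rewrite (ord1 i).
by have -> : lift ord_max ord0 = ord0 :> 'I_2 by apply/val_inj.
Qed.

Lemma osc_point_l p z t k : osc_point p z t 0 (lshift 2 k) = p 0 k.
Proof. by rewrite row_mxEl. Qed.

Lemma osc_point_xi p z t : osc_point p z t 0 (ord_xi n) = z.
Proof. by rewrite row_mxEr mxE. Qed.

Lemma osc_point_zeta p z t : osc_point p z t 0 (ord_zeta n) = t.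
Proof. by rewrite row_mxEr mxE. Qed.

Lemma lsubmx_osc_point p z t : lsubmx (osc_point p z t) = p.
Proof. exact: row_mxKl. Qed.

Lemma osc_rot_l t p i : osc_rot lambda t p 0 (lshift n i) =
  cos (lambda i * t) * p 0 (lshift n i) - sin (lambda i * t) * p 0 (rshift n i).
Proof. by rewrite row_mxEl mxE. Qed.

Lemma osc_rot_r t p i : osc_rot lambda t p 0 (rshift n i) =
  sin (lambda i * t) * p 0 (lshift n i) + cos (lambda i * t) * p 0 (rshift n i).
Proof. by rewrite row_mxEr mxE. Qed.

Lemma row_lrP p q :
  (forall i, p 0 (lshift n i) = q 0 (lshift n i)) ->
  (forall i, p 0 (rshift n i) = q 0 (rshift n i)) -> p = q.
Proof.
by move=> hl hr; apply/rowP => k; case: (split_ordP k) => i ->.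
Qed.

Lemma osc_rot0 p : osc_rot lambda 0 p = p.
Proof.
by apply: row_lrP => i; rewrite !(osc_rot_l, osc_rot_r) mulr0 cos0 sin0; ring.
Qed.

Lemma osc_rotD s t p :
  osc_rot lambda (s + t) p = osc_rot lambda s (osc_rot lambda t p).
Proof.
by apply: row_lrP => i; rewrite !(osc_rot_l, osc_rot_r)
  mulrDr cosD sinD; ring.
Qed.

Lemma osc_rot_add t p q :
  osc_rot lambda t (p + q) = osc_rot lambda t p + osc_rot lambda t q.
Proof.
by apply: row_lrP => i; rewrite [in RHS]mxE !(osc_rot_l, osc_rot_r) !mxE; ring.
Qed.

Lemma osc_rot_scale t r p :
  osc_rot lambda t (r *: p) = r *: osc_rot lambda t p.
Proof.
by apply: row_lrP => i; rewrite [in RHS]mxE !(osc_rot_l, osc_rot_r) !mxE; ring.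
Qed.

Lemma osc_omegaDl p q r : osc_omega (p + q) r = osc_omega p r + osc_omega q r.
Proof.
by rewrite -big_split /=; apply: eq_bigr => i _; rewrite !mxE; ring.
Qed.

Lemma osc_omegaC p q : osc_omega p q = - osc_omega q p.
Proof. by rewrite -sumrN; apply: eq_bigr => i _; ring. Qed.

Lemma osc_omegaDr p q r : osc_omega p (q + r) = osc_omega p q + osc_omega p r.
Proof.
by rewrite -big_split /=; apply: eq_bigr => i _; rewrite !mxE; ring.
Qed.

Lemma osc_omegaZr s p q : osc_omega p (s *: q) = s * osc_omega p q.
Proof.
by rewrite mulr_sumr /=; apply: eq_bigr => i _; rewrite !mxE; ring.
Qed.

Lemma osc_omega_rot t p q :
  osc_omega (osc_rot lambda t p) (osc_rot lambda t q) = osc_omega p q.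
Proof.
apply: eq_bigr => i _; rewrite !(osc_rot_l, osc_rot_r).
rewrite -[RHS]mul1r -(cos2Dsin2 (lambda i * t)); ring.
Qed.

Lemma osc_mulA : associative (osc_mul lambda).
Proof.
move=> a b c; rewrite /osc_mul /= !lsubmx_osc_point !osc_point_xi !osc_point_zeta.
rewrite osc_rotD osc_rot_add osc_omegaDl osc_omegaDr osc_omega_rot.
congr osc_point; [exact: addrA|ring|exact: addrA].
Qed.

Lemma osc_pointK a :
  osc_point (lsubmx a) (a 0 (ord_xi n)) (a 0 (ord_zeta n)) = a.
Proof.
apply/rowP; apply: osc_ordP => [i|i||].
- by rewrite osc_point_l mxE.
- by rewrite osc_point_l mxE.
- by rewrite osc_point_xi.
- by rewrite osc_point_zeta.
Qed.

Lemma osc_mul0l : left_id 0 (osc_mul lambda).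
Proof.
move=> a; rewrite /osc_mul /= !mxE osc_rot0 linear0 !add0r.
suff -> : osc_omega 0 (lsubmx a) = 0 by rewrite mulr0 addr0 osc_pointK.
by apply: big1 => i _; rewrite !mxE !mul0r subrr.
Qed.

Definition osc_inv a : point :=
  osc_point (osc_rot lambda (- a 0 (ord_zeta n)) (- lsubmx a))
    (- a 0 (ord_xi n)) (- a 0 (ord_zeta n)).

Lemma osc_mulV a : osc_mul lambda (osc_inv a) a = 0.
Proof.
rewrite /osc_mul /osc_inv /= lsubmx_osc_point osc_point_xi osc_point_zeta.
rewrite -osc_rot_add addNr !addNr add0r osc_omega_rot.
have -> : osc_omega (- lsubmx a) (lsubmx a) = 0.
  by apply: big1 => i _; rewrite !mxE; ring.
have -> : osc_rot lambda (- a 0 (ord_zeta n)) 0 = 0.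
  by apply: row_lrP => i; rewrite !(osc_rot_l, osc_rot_r) !mxE; ring.
rewrite mulr0; apply/rowP; apply: osc_ordP => [i|i||].
- by rewrite osc_point_l !mxE.
- by rewrite osc_point_l !mxE.
- by rewrite osc_point_xi mxE.
- by rewrite osc_point_zeta mxE.
Qed.

(* The differential of the left translation by a, which is the same at every
   point because translations are affine in these coordinates. *)
Definition osc_lin a v : point :=
  osc_point (osc_rot lambda (a 0 (ord_zeta n)) (lsubmx v))
    (v 0 (ord_xi n)
     + 2^-1 * osc_omega (lsubmx a)
                (osc_rot lambda (a 0 (ord_zeta n)) (lsubmx v)))
    (v 0 (ord_zeta n)).

Lemma osc_mulE a b : osc_mul lambda a b = a + osc_lin a b.
Proof.
rewrite -{2}(osc_pointK a); apply/rowP; apply: osc_ordP => [i|i||];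
  rewrite [RHS]mxE /osc_mul /osc_lin.
- by rewrite !osc_point_l [LHS]mxE.
- by rewrite !osc_point_l [LHS]mxE.
- by rewrite !osc_point_xi addrA.
- by rewrite !osc_point_zeta.
Qed.

Lemma osc_lin_is_linear a : linear (osc_lin a).
Proof.
move=> r u v; apply/rowP; apply: osc_ordP => [i|i||];
  rewrite [RHS]mxE [X in _ = X + _]mxE /osc_lin linearD /= linearZ /=
    osc_rot_add osc_rot_scale.
- by rewrite !osc_point_l [LHS]mxE [X in X + _]mxE.
- by rewrite !osc_point_l [LHS]mxE [X in X + _]mxE.
- by rewrite !osc_point_xi osc_omegaDr osc_omegaZr !mxE; ring.
- by rewrite !osc_point_zeta !mxE.
Qed.

HB.instance Definition _ a :=
  GRing.isLinear.Build R point point _ (osc_lin a) (osc_lin_is_linear a).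

Lemma derive_osc_mul a x v : 'D_v (osc_mul lambda a) x = osc_lin a v.
Proof.
rewrite /derive; apply: lim_near_cst => //.
near=> h.
have h0 : h != 0 by near: h; exact: nbhs_dnbhs_neq.
rewrite /= !osc_mulE (linearP (osc_lin a)) opprD addrACA subrr add0r addrK.
by rewrite scalerA mulVf ?scale1r.
Unshelve. all: by end_near. Qed.

Lemma canonical_frameE k x : frame k x = osc_lin x (basis_vec R k).
Proof. exact: derive_osc_mul. Qed.

Lemma osc_lin_mul a x v : osc_lin (osc_mul lambda a x) v = osc_lin a (osc_lin x v).
Proof.
rewrite /osc_lin /osc_mul /= !lsubmx_osc_point !osc_point_xi !osc_point_zeta.
rewrite osc_rotD osc_omegaDl osc_omega_rot; congr osc_point; ring.
Qed.

Lemma canonical_frame_left_invariant k : left_invariant lambda (frame k).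
Proof. by move=> a x; rewrite derive_osc_mul !canonical_frameE osc_lin_mul. Qed.

Lemma canonical_frame_mxE x : canonical_frame_mx lambda x = lin1_mx (osc_lin x).
Proof.
by apply/row_matrixP => k; rewrite rowK canonical_frameE rowE mul_rV_lin1.
Qed.

Lemma osc_lin0 v : osc_lin 0 v = v.
Proof. by have := osc_mulE 0 v; rewrite osc_mul0l add0r. Qed.

Lemma osc_linK a v : osc_lin (osc_inv a) (osc_lin a v) = v.
Proof. by rewrite -osc_lin_mul osc_mulV osc_lin0. Qed.

Lemma canonical_frame_mx_unit x : canonical_frame_mx lambda x \in unitmx.
Proof.
rewrite canonical_frame_mxE.
apply: (proj1 (@mulmx1_unit _ _ _ (lin1_mx (osc_lin (osc_inv x))) _)).
apply/row_matrixP => k; rewrite !rowE mulmx1 mulmxA !mul_rV_lin1 /=; exact: osc_linK.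
Qed.

Lemma osc_metric_frame x u v :
  form_eval (osc_metric lambda x) (osc_lin x u) (osc_lin x v) = (u *m v^T) 0 0.
Proof.
rewrite /form_eval /osc_metric -!(mul_rV_lin1 (osc_lin x)) -canonical_frame_mxE.
have h := canonical_frame_mx_unit x.
rewrite !mulmxA -(mulmxA u) mulmxV // mulmx1 -mulmxA -trmx_mul.
by rewrite -mulmxA mulmxV // mulmx1.
Qed.

Lemma canonical_frame_orthonormal : orthonormal_frame (osc_metric lambda) frame.
Proof.
move=> x i j; rewrite !canonical_frameE osc_metric_frame.
rewrite /basis_vec trmx_delta mul_delta_mx_cond.
by case: eqP => _; rewrite ?mulr1n ?mulr0n !mxE.
Qed.

(* Multiplication by i t lambda in C^n. *)
Definition osc_J (t : R) p : 'rV[R]_(n + n) :=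
  row_mx (\row_i (- (t * lambda i * p 0 (rshift n i))))
         (\row_i (t * lambda i * p 0 (lshift n i))).

Definition osc_bracket u v : point :=
  osc_point (osc_J (u 0 (ord_zeta n)) (lsubmx v)
             - osc_J (v 0 (ord_zeta n)) (lsubmx u))
    (osc_omega (lsubmx u) (lsubmx v)) 0.

Lemma osc_J_l t p i :
  osc_J t p 0 (lshift n i) = - (t * lambda i * p 0 (rshift n i)).
Proof. by rewrite row_mxEl mxE. Qed.

Lemma osc_J_r t p i :
  osc_J t p 0 (rshift n i) = t * lambda i * p 0 (lshift n i).
Proof. by rewrite row_mxEr mxE. Qed.

Let is_derive_cos_coord x u i :
  is_derive x u (fun y => cos (lambda i * y 0 (ord_zeta n)))
    (- sin (lambda i * x 0 (ord_zeta n)) * (lambda i * u 0 (ord_zeta n))).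
Proof.
have h := is_derive_coord x u (ord_zeta n).
have hl : is_derive x u (lambda i \*: (fun y : point => y 0 (ord_zeta n)))
  (lambda i *: u 0 (ord_zeta n)).
  exact: is_deriveZ.
exact: (is_derive_compR (is_derive_cos _) hl).
Qed.

Let is_derive_sin_coord x u i :
  is_derive x u (fun y => sin (lambda i * y 0 (ord_zeta n)))
    (cos (lambda i * x 0 (ord_zeta n)) * (lambda i * u 0 (ord_zeta n))).
Proof.
have h := is_derive_coord x u (ord_zeta n).
have hl : is_derive x u (lambda i \*: (fun y : point => y 0 (ord_zeta n)))
  (lambda i *: u 0 (ord_zeta n)).
  exact: is_deriveZ.
exact: (is_derive_compR (is_derive_sin _) hl).
Qed.

Let is_derive_rot x u p k :
  is_derive x u (fun y => osc_rot lambda (y 0 (ord_zeta n)) p 0 k)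
    (osc_rot lambda (x 0 (ord_zeta n)) (osc_J (u 0 (ord_zeta n)) p) 0 k).
Proof.
case: (split_ordP k) => i ->.
- rewrite osc_rot_l osc_J_l osc_J_r.
  under [X in is_derive _ _ X _]eq_fun do rewrite osc_rot_l.
  have hc := is_derive_cos_coord x u i; have hs := is_derive_sin_coord x u i.
  have := is_deriveB
    (is_deriveM hc (is_derive_cst (p 0 (lshift n i)) x u))
    (is_deriveM hs (is_derive_cst (p 0 (rshift n i)) x u)).
  move/is_derive_eq; apply; rewrite /GRing.scale /=; ring.
- rewrite osc_rot_r osc_J_l osc_J_r.
  under [X in is_derive _ _ X _]eq_fun do rewrite osc_rot_r.
  have hc := is_derive_cos_coord x u i; have hs := is_derive_sin_coord x u i.
  have := is_deriveD
    (is_deriveM hs (is_derive_cst (p 0 (lshift n i)) x u))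
    (is_deriveM hc (is_derive_cst (p 0 (rshift n i)) x u)).
  move/is_derive_eq; apply; rewrite /GRing.scale /=; ring.
Qed.

Let is_derive_omega (f h : point -> 'rV[R]_(n + n)) (df dh : 'rV[R]_(n + n)) x u :
  (forall k, is_derive x u (fun y => f y 0 k) (df 0 k)) ->
  (forall k, is_derive x u (fun y => h y 0 k) (dh 0 k)) ->
  is_derive x u (fun y => osc_omega (f y) (h y))
    (osc_omega df (h x) + osc_omega (f x) dh).
Proof.
move=> hf hh; rewrite /osc_omega -big_split /=.
pose F i y := f y 0 (lshift n i) * h y 0 (rshift n i)
              - f y 0 (rshift n i) * h y 0 (lshift n i).
have -> : (fun y => \sum_(i < n) F i y) = \sum_(i < n) F i.
  by apply/funext => y; rewrite fct_sumE.
apply: is_derive_sum => i.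
have := is_deriveB (is_deriveM (hf (lshift n i)) (hh (rshift n i)))
                   (is_deriveM (hf (rshift n i)) (hh (lshift n i))).
move/is_derive_eq; apply; rewrite /GRing.scale /=; ring.
Qed.

Lemma is_derive_osc_lin x u v :
  is_derive x u (fun y => osc_lin y v)
    (osc_point
       (osc_rot lambda (x 0 (ord_zeta n)) (osc_J (u 0 (ord_zeta n)) (lsubmx v)))
       (2^-1 * (osc_omega (lsubmx u)
                  (osc_rot lambda (x 0 (ord_zeta n)) (lsubmx v))
                + osc_omega (lsubmx x)
                    (osc_rot lambda (x 0 (ord_zeta n))
                       (osc_J (u 0 (ord_zeta n)) (lsubmx v)))))
       0).
Proof.
apply: is_derive_row; apply: osc_ordP => [i|i||].
- rewrite osc_point_l; under [X in is_derive _ _ X _]eq_fun do rewrite osc_point_l.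
  exact: is_derive_rot.
- rewrite osc_point_l; under [X in is_derive _ _ X _]eq_fun do rewrite osc_point_l.
  exact: is_derive_rot.
- rewrite osc_point_xi; under [X in is_derive _ _ X _]eq_fun do rewrite osc_point_xi.
  have ho := @is_derive_omega lsubmx
    (fun y => osc_rot lambda (y 0 (ord_zeta n)) (lsubmx v)) (lsubmx u)
    (osc_rot lambda (x 0 (ord_zeta n)) (osc_J (u 0 (ord_zeta n)) (lsubmx v))) x u.
  have {}ho := ho _ (is_derive_rot x u (lsubmx v)).
  have hl k : is_derive x u (fun y : point => lsubmx y 0 k) (lsubmx u 0 k).
    rewrite mxE; under [X in is_derive _ _ X _]eq_fun do rewrite mxE.
    exact: is_derive_coord.
  have := is_deriveD (is_derive_cst (v 0 (ord_xi n)) x u)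
                     (is_deriveZ 2^-1 (ho hl)).
  move/is_derive_eq; apply; rewrite /GRing.scale /=; ring.
- rewrite osc_point_zeta.
  under [X in is_derive _ _ X _]eq_fun do rewrite osc_point_zeta.
  exact: is_derive_cst.
Qed.

Lemma osc_lin_bracket u v x :
  lie_bracket (fun y => osc_lin y u) (fun y => osc_lin y v) x
  = osc_lin x (osc_bracket u v).
Proof.
rewrite /lie_bracket.
case: (is_derive_osc_lin x (osc_lin x u) v) => _ ->.
case: (is_derive_osc_lin x (osc_lin x v) u) => _ ->.
rewrite /osc_bracket /osc_lin !lsubmx_osc_point !osc_point_xi !osc_point_zeta.
set t := x 0 (ord_zeta n); set ju := osc_J _ (lsubmx v); set jv := osc_J _ (lsubmx u).
have e : osc_rot lambda t (ju - jv) = osc_rot lambda t ju - osc_rot lambda t jv.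
  by rewrite osc_rot_add -(scaleN1r jv) osc_rot_scale scaleN1r.
rewrite e !osc_omega_rot; apply/rowP; apply: osc_ordP => [i|i||];
  rewrite [LHS]mxE [X in _ + X]mxE !(osc_point_l, osc_point_xi, osc_point_zeta).
- by rewrite [RHS]mxE [X in _ = _ + X]mxE.
- by rewrite [RHS]mxE [X in _ = _ + X]mxE.
- rewrite osc_omegaDr -[- osc_rot _ _ _]scaleN1r osc_omegaZr.
  rewrite (osc_omegaC (lsubmx v)); by field.
- by rewrite subr0.
Qed.

Lemma lie_bracket_frame k l x :
  lie_bracket (frame k) (frame l) x
  = osc_lin x (osc_bracket (basis_vec R k) (basis_vec R l)).
Proof.
have E i : frame i = fun y => osc_lin y (basis_vec R i).
  by apply/funext => y; rewrite canonical_frameE.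
by rewrite !E osc_lin_bracket.
Qed.

Let lsubmx_e i : lsubmx (basis_vec R (ord_e i)) = delta_mx 0 (lshift n i).
Proof. by apply/rowP => k; rewrite !mxE (inj_eq (@lshift_inj _ _)). Qed.

Let lsubmx_f i : lsubmx (basis_vec R (ord_f i)) = delta_mx 0 (rshift n i).
Proof. by apply/rowP => k; rewrite !mxE (inj_eq (@lshift_inj _ _)). Qed.

Let lsubmx_r (j : 'I_2) : lsubmx (basis_vec R (rshift (n + n) j)) = 0.
Proof. by apply/rowP => k; rewrite !mxE eq_lrshift. Qed.

Let zeta_l k : basis_vec R (lshift 2 k) 0 (ord_zeta n) = 0.
Proof. by rewrite mxE eq_rlshift. Qed.

Let zeta_xi : basis_vec R (ord_xi n) 0 (ord_zeta n) = 0.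
Proof. by rewrite mxE (inj_eq (@rshift_inj _ _)). Qed.

Let zeta_zeta : basis_vec R (ord_zeta n) 0 (ord_zeta n) = 1.
Proof. by rewrite mxE !eqxx. Qed.

Let J0 p : osc_J 0 p = 0.
Proof.
by apply: row_lrP => i; rewrite ?osc_J_l ?osc_J_r !mul0r ?oppr0 mxE.
Qed.

Let Jz t : osc_J t 0 = 0.
Proof.
by apply: row_lrP => i; rewrite ?osc_J_l ?osc_J_r !mxE mulr0 ?oppr0.
Qed.

Let omega0l p : osc_omega 0 p = 0.
Proof. by apply: big1 => i _; rewrite !mxE !mul0r subrr. Qed.

Let omega0r p : osc_omega p 0 = 0.
Proof. by rewrite osc_omegaC omega0l oppr0. Qed.

Let point0 : @osc_point R n 0 0 0 = 0.
Proof.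
apply/rowP; apply: osc_ordP => [i|i||];
by rewrite ?osc_point_l ?osc_point_xi ?osc_point_zeta !mxE.
Qed.

Lemma bracket_e_f i j x :
  lie_bracket (frame (ord_e i)) (frame (ord_f j)) x
  = (i == j)%:R *: frame (ord_xi n) x.
Proof.
rewrite lie_bracket_frame canonical_frameE -linearZ /=; congr osc_lin.
rewrite /osc_bracket !zeta_l !J0 subrr lsubmx_e lsubmx_f.
have -> : osc_omega (delta_mx 0 (lshift n i)) (delta_mx 0 (rshift n j))
          = (i == j)%:R :> R.
  rewrite /osc_omega (bigD1 i) //= big1 => [|k ki]; last first.
    rewrite !mxE !(inj_eq (@lshift_inj _ _)) !eq_lrshift !eq_rlshift !eqxx /=.
    by rewrite (negPf ki) mul0r mulr0 subrr.
  rewrite !mxE !(inj_eq (@lshift_inj _ _)) !(inj_eq (@rshift_inj _ _)).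
  by rewrite !eq_rlshift !eqxx /= mul1r mul0r subr0 addr0.
apply/rowP; apply: osc_ordP => [k|k||];
rewrite ?osc_point_l ?osc_point_xi ?osc_point_zeta !mxE.
- by rewrite eq_lrshift mulr0.
- by rewrite eq_lrshift mulr0.
- by rewrite !eqxx mulr1.
- by rewrite (inj_eq (@rshift_inj _ _)) mulr0.
Qed.

Lemma bracket_zeta_e j x :
  lie_bracket (frame (ord_zeta n)) (frame (ord_e j)) x
  = lambda j *: frame (ord_f j) x.
Proof.
rewrite lie_bracket_frame canonical_frameE -linearZ /=; congr osc_lin.
rewrite /osc_bracket !zeta_l zeta_zeta J0 subr0 lsubmx_r lsubmx_e omega0l.
apply/rowP; apply: osc_ordP => [k|k||].
- rewrite osc_point_l osc_J_l !mxE eq_rlshift /= mulr0 oppr0.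
  by rewrite (inj_eq (@lshift_inj _ _)) eq_lrshift mulr0.
- rewrite osc_point_l osc_J_r !mxE !(inj_eq (@lshift_inj _ _)).
  rewrite (inj_eq (@rshift_inj _ _)) mul1r /=.
  by case: eqP => [->|]; rewrite ?mulr0.
- by rewrite osc_point_xi !mxE eq_rlshift mulr0.
- by rewrite osc_point_zeta !mxE eq_rlshift mulr0.
Qed.

Lemma bracket_zeta_f j x :
  lie_bracket (frame (ord_zeta n)) (frame (ord_f j)) x
  = - lambda j *: frame (ord_e j) x.
Proof.
rewrite lie_bracket_frame canonical_frameE -linearZ /=; congr osc_lin.
rewrite /osc_bracket !zeta_l zeta_zeta J0 subr0 lsubmx_r lsubmx_f omega0l.
apply/rowP; apply: osc_ordP => [k|k||].
- rewrite osc_point_l osc_J_l !mxE !(inj_eq (@lshift_inj _ _)).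
  rewrite (inj_eq (@rshift_inj _ _)) mul1r /=.
  by case: eqP => [->|]; rewrite ?mulr0 ?oppr0 ?mulNr.
- rewrite osc_point_l osc_J_r !mxE eq_lrshift /= mulr0.
  by rewrite (inj_eq (@lshift_inj _ _)) eq_rlshift mulr0.
- by rewrite osc_point_xi !mxE eq_rlshift mulr0.
- by rewrite osc_point_zeta !mxE eq_rlshift mulr0.
Qed.

Lemma bracket_e_e i j x : lie_bracket (frame (ord_e i)) (frame (ord_e j)) x = 0.
Proof.
rewrite lie_bracket_frame /osc_bracket !zeta_l !J0 subrr !lsubmx_e.
rewrite /osc_omega big1 ?point0 ?linear0 // => k _.
by rewrite !mxE !eq_rlshift mulr0 mul0r subrr.
Qed.

Lemma bracket_f_f i j x : lie_bracket (frame (ord_f i)) (frame (ord_f j)) x = 0.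
Proof.
rewrite lie_bracket_frame /osc_bracket !zeta_l !J0 subrr !lsubmx_f.
rewrite /osc_omega big1 ?point0 ?linear0 // => k _.
by rewrite !mxE !eq_lrshift mulr0 mul0r subrr.
Qed.

Lemma bracket_xi k x : lie_bracket (frame (ord_xi n)) (frame k) x = 0.
Proof.
rewrite lie_bracket_frame /osc_bracket zeta_xi J0 lsubmx_r Jz subrr omega0l.
by rewrite point0 linear0.
Qed.

End OscillatorFacts.

(* Main.v *)
(* Trivialize the tangent bundle by the left-invariant frame and write L_a for
   the Levi-Civita operator of a left-invariant field a, that is L_a b is the
   covariant derivative of b along a.  The group acts on its coordinates by
   affine maps, so the flat connection of the coordinates is left-invariant too;
   this gives the derivatives of the frame and of the Sasaki metric in closed
   form.

   Let V be left-invariant with value nu at the unit.  Applying the Koszul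
   formula of the Sasaki metric to the trace of the second derivative of V, the
   part tangent to V(G) drops out, the trace of an inner derivation vanishes by
   unimodularity, and what remains is
     sum_kj H_kj L_(e_k) L_(e_j) nu,
   where H is the inverse of the matrix of the metric induced by V.  Hence V is
   minimal as soon as this vector is a multiple of nu.

   When all lambda_i equal l, write nu = w + a xi + b zeta with w in C^n.  The
   first harmonicity condition says that nu is an eigenvector of
   - diag(1/2 + l^2, n/2, 0), and the second one says n a i w = 0 when b = 0.
   So nu is horizontal (nu = w), or nu = +-xi, or nu = +-zeta; in each case H is
   a multiple of the identity corrected by two operators of rank one, and the
   criterion holds. *)

Require Import Defs.
From HB Require Import structures.
From mathcomp Require Import all_boot all_order all_algebra.
From mathcomp Require Import all_classical all_reals all_analysis.
From mathcomp Require Import ring lra.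
Import Order.TTheory GRing.Theory Num.Theory.
Import numFieldNormedType.Exports.

Set Implicit Arguments.
Unset Strict Implicit.
Unset Printing Implicit Defensive.

Local Open Scope ring_scope.

(** * Entrywise differentiation of matrix-valued maps *)

Section MxDerive.
Variables (R : realType) (m : nat).
Implicit Types x v : 'rV[R]_m.

(** Entrywise, so that product and block rules follow from scalar calculus for every matrix format;
    [mx_derive_row] goes back to derivatives of row-valued maps. *)
Definition mx_derive p q (F : 'rV[R]_m -> 'M[R]_(p, q)) x v (dF : 'M[R]_(p, q))
  :=
  forall i j, is_derive x v (fun y => F y i j) (dF i j).

Lemma is_derive_sumf (I : finType) (f : I -> 'rV[R]_m -> R) (df : I -> R) x v :
  (forall i, is_derive x v (f i) (df i)) ->
  is_derive x v (fun y => \sum_i f i y) (\sum_i df i).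
Proof.
move=> h; have -> : (fun y => \sum_i f i y) = \sum_i f i.
  by apply/funext => y; rewrite fct_sumE.
elim/big_ind2: _ => [|? ? ? ? h1 h2|i _];
  [exact: is_derive_cst|exact: is_deriveD|exact: h].
Qed.

Lemma mx_derive_id x v : mx_derive id x v v.
Proof. by move=> i j; rewrite (ord1 i); exact: is_derive_coord. Qed.

Lemma mx_derive_cst p q (A : 'M[R]_(p, q)) x v : mx_derive (fun=> A) x v 0.
Proof. by move=> i j; rewrite mxE; exact: is_derive_cst. Qed.

Lemma mx_deriveM p q r (F : 'rV[R]_m -> 'M[R]_(p, q))
    (H : 'rV[R]_m -> 'M[R]_(q, r)) dF dH x v :
  mx_derive F x v dF -> mx_derive H x v dH ->
  mx_derive (fun y => F y *m H y) x v (dF *m H x + F x *m dH).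
Proof.
move=> hF hH i j; rewrite !mxE -big_split /=.
under [X in is_derive _ _ X _]eq_fun do rewrite mxE.
apply: is_derive_sumf => k.
have := is_deriveM (hF i k) (hH k j).
move/is_derive_eq; apply; rewrite /GRing.scale /=; ring.
Qed.

(** Each entry of [f A] is a finite combination of entries of [A] with constant coefficients. *)
Lemma mx_derive_linear p q r s (f : {linear 'M[R]_(p, q) -> 'M[R]_(r, s)})
    (F : 'rV[R]_m -> 'M[R]_(p, q)) dF x v :
  mx_derive F x v dF -> mx_derive (fun y => f (F y)) x v (f dF).
Proof.
move=> hF i j.
have fE A : f A i j = \sum_k \sum_l A k l * f (delta_mx k l) i j.
  rewrite {1}(matrix_sum_delta A) linear_sum summxE; apply: eq_bigr => k _.
  by rewrite linear_sum summxE; apply: eq_bigr => l _; rewrite linearZ mxE.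
rewrite fE; under [X in is_derive _ _ X _]eq_fun do rewrite fE.
apply: is_derive_sumf => k; apply: is_derive_sumf => l.
have := is_deriveM (hF k l) (is_derive_cst (f (delta_mx k l) i j) x v).
move/is_derive_eq; apply; rewrite /GRing.scale /=; ring.
Qed.

Lemma mx_derive_block p1 p2 q1 q2 
   (A : 'rV[R]_m -> 'M[R]_(p1, q1)) (B : 'rV[R]_m -> 'M[R]_(p1, q2))
   (C : 'rV[R]_m -> 'M[R]_(p2, q1)) (D : 'rV[R]_m -> 'M[R]_(p2, q2)) dA dB dC
     dD x v :
  mx_derive A x v dA -> mx_derive B x v dB -> mx_derive C x v dC ->
  mx_derive D x v dD ->
  mx_derive (fun y => block_mx (A y) (B y) (C y) (D y)) x v (block_mx dA dB dC
    dD).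
Proof.
move=> hA hB hC hD i j.
by case: (split_ordP i) => i' ->; case: (split_ordP j) => j' ->;
  rewrite ?(block_mxEul, block_mxEur, block_mxEdl, block_mxEdr);
  under [X in is_derive _ _ X _]eq_fun do
    rewrite ?(block_mxEul, block_mxEur, block_mxEdl, block_mxEdr).
Qed.

Lemma mx_derive_row k (f : 'rV[R]_m -> 'rV[R]_k) df x v :
  mx_derive f x v df -> is_derive x v f df.
Proof. by move=> h; apply: is_derive_row => j; exact: h. Qed.

End MxDerive.

(** Both derivatives are those of the same function of one variable, [F] restricted to the line
    through [l x] with direction [l v]. *)
Lemma mx_derive_precomp (R : realType) m k p q (l : {linear 'rV[R]_m ->
  'rV[R]_k})
    (F : 'rV[R]_k -> 'M[R]_(p, q)) (dF : 'M[R]_(p, q)) x v :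
  mx_derive F (l x) (l v) dF -> mx_derive (fun y => F (l y)) x v dF.
Proof.
move=> hF i j; have [fd fb] := hF i j.
have e : (fun h : R => F (l (h *: v + x)) i j)
         = (fun h : R => F (h *: l v + l x) i j).
  by apply/funext => h; rewrite linearP.
have fd' : derivable (fun h : R => F (l (h *: v + x)) i j) 0 1.
  by rewrite e; move/derivable1P: fd.
apply: DeriveDef; first exact/derivable1P.
by rewrite -derive_line e (derive_line (fun y => F y i j)).
Qed.

Lemma mx_derive_row_mx (R : realType) m p q1 q2
   (A : 'rV[R]_m -> 'M[R]_(p, q1)) (B : 'rV[R]_m -> 'M[R]_(p, q2)) dA dB x v :
  mx_derive A x v dA -> mx_derive B x v dB ->
  mx_derive (fun y => row_mx (A y) (B y)) x v (row_mx dA dB).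
Proof.
move=> hA hB i j.
by case: (split_ordP j) => j' ->; rewrite ?(row_mxEl, row_mxEr);
  under [X in is_derive _ _ X _]eq_fun do rewrite ?(row_mxEl, row_mxEr).
Qed.

Lemma is_derive_mx (R : realType) m k (f : 'rV[R]_m -> 'rV[R]_k) df (y v :
  'rV[R]_m) :
  is_derive y v f df -> mx_derive f y v df.
Proof.
move=> [d e] i j; rewrite (ord1 i); have /derivable_mxP/(_ 0 j) dj := d.
by apply: DeriveDef => //; rewrite -e derive_mx // mxE.
Qed.

(** * The Koszul formula in coordinates *)

Section LeviCivita.
Variables (R : realType) (N : nat).
Implicit Types (G : 'rV[R]_N -> 'M[R]_N) (p u v w : 'rV[R]_N).

Lemma form_evalE (A : 'M[R]_N) u v :
  form_eval A u v = \sum_i \sum_j u 0 i * A i j * v 0 j.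
Proof.
rewrite /form_eval mxE exchange_big; apply: eq_bigr => j _ /=.
by rewrite !mxE mulr_suml.
Qed.

Lemma linear_sum_basis M (p q : nat) (f : {linear 'rV[R]_M -> 'M[R]_(p, q)}) (u
  : 'rV[R]_M) :
  f u = \sum_i u 0 i *: f (basis_vec R i).
Proof.
by rewrite {1}(row_sum_delta u) linear_sum; apply: eq_bigr => i _;
  rewrite linearZ.
Qed.

(** The Koszul formula for fields with constant coordinates, whose brackets vanish. Linearity of
    [DG] extends the derivatives from the basis directions to all directions. *)
Lemma koszul_formula G (DG : {linear 'rV[R]_N -> 'M[R]_N}) p u v w :
  (G p)^T = G p -> G p \in unitmx ->
  (forall i, mx_derive G p (basis_vec R i) (DG (basis_vec R i))) ->
  2 * form_eval (G p) (christoffel_form G p u v) w =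
  form_eval (DG u) v w + form_eval (DG v) u w - form_eval (DG w) u v.
Proof.
move=> Gs Gu hG.
have pE i j l : partial i (fun y => G y j l) p = DG (basis_vec R i) j l.
  by case: (hG i j l).
pose K i j l := DG (basis_vec R i) j l + DG (basis_vec R j) i l
     - DG (basis_vec R l) i j.
(* Lowering the upper index with [G p] cancels the inverse matrix in the Christoffel symbols. *)
have Ge l : (christoffel_form G p u v *m G p) 0 l =
    2^-1 * \sum_i \sum_j u 0 i * v 0 j * K i j l.
  transitivity (\sum_i \sum_j u 0 i * v 0 j *
      (\sum_k G p l k * christoffel G k i j p)).
    rewrite mxE; under eq_bigr do rewrite mxE mulr_suml.
    rewrite exchange_big; apply: eq_bigr => i _.
    under eq_bigr do rewrite mulr_suml.
    rewrite exchange_big; apply: eq_bigr => j _.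
    rewrite mulr_sumr; apply: eq_bigr => k _.
    have -> : G p k l = G p l k by rewrite -{1}Gs mxE.
    ring.
  rewrite mulr_sumr; apply: eq_bigr => i _.
  rewrite mulr_sumr; apply: eq_bigr => j _.
  transitivity (u 0 i * v 0 j * (2^-1 * \sum_k (G p *m invmx (G p)) l k * K i j
    k)).
    congr (_ * _); under eq_bigr do rewrite /christoffel mulrCA mulr_sumr.
    rewrite -mulr_sumr exchange_big; congr (_ * _); apply: eq_bigr => k _.
    rewrite !pE mxE mulr_suml; apply: eq_bigr => k' _; rewrite /K; ring.
  rewrite mulmxV // (bigD1 l) //= big1 => [|k kl].
    by rewrite mxE eqxx mulr1n; ring.
  by rewrite mxE eq_sym (negPf kl) mul0r.
rewrite {1}/form_eval mxE.
under eq_bigr do rewrite Ge [_^T _ _]mxE -mulrA.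
rewrite -mulr_sumr mulrA divff ?pnatr_eq0 // mul1r.
have E a b c : form_eval (DG a) b c =
    \sum_k \sum_i \sum_j a 0 i * b 0 j * c 0 k * DG (basis_vec R i) j k.
  rewrite form_evalE exchange_big /=; apply: eq_bigr => k _.
  rewrite [RHS]exchange_big; apply: eq_bigr => j _.
  rewrite linear_sum_basis summxE mulr_sumr mulr_suml; apply: eq_bigr => i _.
  by rewrite mxE; ring.
rewrite !E.
(* The second and third sums are reindexed so that all three run over the same monomials in [u],
   [v], [w]. *)
have -> : \sum_k \sum_i \sum_j v 0 i * u 0 j * w 0 k * DG (basis_vec R i) j k =
    \sum_k \sum_i \sum_j u 0 i * v 0 j * w 0 k * DG (basis_vec R j) i k.
  apply: eq_bigr => k _; rewrite exchange_big; apply: eq_bigr => i _.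
  by apply: eq_bigr => j _; ring.
have -> : \sum_k \sum_i \sum_j w 0 i * u 0 j * v 0 k * DG (basis_vec R i) j k =
    \sum_k \sum_i \sum_j u 0 i * v 0 j * w 0 k * DG (basis_vec R k) i j.
  rewrite exchange_big; apply: eq_bigr => k _ /=.
  rewrite exchange_big; apply: eq_bigr => i _.
  by apply: eq_bigr => j _; ring.
rewrite -big_split -sumrB; apply: eq_bigr => k _ /=.
rewrite mulr_suml -big_split -sumrB; apply: eq_bigr => i _ /=.
rewrite mulr_suml -big_split -sumrB; apply: eq_bigr => j _ /=.
by rewrite /K; ring.
Qed.

Lemma form_evalP (A : 'M[R]_N) c u v w :
  form_eval A (c *: u + v) w = c * form_eval A u w + form_eval A v w.
Proof. by rewrite /form_eval !mulmxDl -!scalemxAl !mxE. Qed.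

Lemma form_evalC (A : 'M[R]_N) u v :
  A^T = A -> form_eval A u v = form_eval A v u.
Proof.
move=> As; have E : (u *m A *m v^T)^T = v *m A *m u^T.
  by rewrite !trmx_mul trmxK As mulmxA.
by rewrite /form_eval -E [RHS]mxE.
Qed.

End LeviCivita.

(** * The dot product of rows and metrics given by a coframe *)

Section RowDot.
Variable R : realType.

Definition rdot N (u v : 'rV[R]_N) : R := (u *m v^T) 0 0.

Variable N : nat.
Implicit Types (u v w : 'rV[R]_N).

Lemma rdotC u v : rdot u v = rdot v u.
Proof. by rewrite /rdot -{1}(trmxK u) -trmx_mul mxE. Qed.

Lemma rdotDl u v w : rdot (u + v) w = rdot u w + rdot v w.
Proof. by rewrite /rdot mulmxDl mxE. Qed.

Lemma rdotZl c u w : rdot (c *: u) w = c * rdot u w.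
Proof. by rewrite /rdot -scalemxAl mxE. Qed.

Lemma rdotNl u w : rdot (- u) w = - rdot u w.
Proof. by rewrite /rdot mulNmx mxE. Qed.

Lemma rdotDr u v w : rdot w (u + v) = rdot w u + rdot w v.
Proof. by rewrite !(rdotC w) rdotDl. Qed.

Lemma rdotNr u w : rdot w (- u) = - rdot w u.
Proof. by rewrite !(rdotC w) rdotNl. Qed.

Lemma rdotZr c u w : rdot w (c *: u) = c * rdot w u.
Proof. by rewrite !(rdotC w) rdotZl. Qed.

Lemma rdot0l w : rdot 0 w = 0.
Proof. by rewrite /rdot mul0mx mxE. Qed.

Lemma rdot_suml (I : finType) (f : I -> 'rV[R]_N) w :
  rdot (\sum_i f i) w = \sum_i rdot (f i) w.
Proof. by rewrite /rdot mulmx_suml summxE. Qed.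

Lemma rdot_mul M (A : 'M[R]_(M, N)) (u : 'rV[R]_M) v :
  rdot (u *m A) v = rdot u (v *m A^T).
Proof. by rewrite /rdot trmx_mul trmxK mulmxA. Qed.

Lemma rdot_row M (u1 u2 : 'rV[R]_M) v1 v2 :
  rdot (row_mx u1 v1) (row_mx u2 v2) = rdot u1 u2 + rdot v1 v2.
Proof. by rewrite /rdot tr_row_mx mul_row_col mxE. Qed.

Lemma rdot_delta M P (A : 'M[R]_(M, N)) (B : 'M[R]_(P, N)) i j :
  rdot (delta_mx 0 i *m A) (delta_mx 0 j *m B) = (A *m B^T) i j.
Proof.
rewrite /rdot trmx_mul trmx_delta mulmxA -(mulmxA (delta_mx 0 i)) -rowE.
by rewrite -colE !mxE.
Qed.

Lemma rdot_inj u v : (forall w, rdot u w = rdot v w) -> u = v.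
Proof.
move=> h; apply/rowP => j; have := h (delta_mx 0 j).
by rewrite /rdot trmx_delta -!colE !mxE.
Qed.

Lemma form_eval_frame (T : 'M[R]_N) u v :
  form_eval (T *m T^T) u v = rdot (u *m T) (v *m T).
Proof. by rewrite /form_eval /rdot trmx_mul !mulmxA. Qed.

(** Leibniz rule for [T *m T^T] inside the Koszul formula. The six terms are grouped into two halves
    exchanged by [u] and [v], so that a trace against a symmetric matrix needs one half only. *)
Lemma koszul_frame (T : 'rV[R]_N -> 'M[R]_N) (DT : 'rV[R]_N -> 'M[R]_N) p u v w
  :
  linear DT -> T p \in unitmx ->
  (forall i, mx_derive T p (basis_vec R i) (DT (basis_vec R i))) ->
  2 * rdot (christoffel_form (fun q => T q *m (T q)^T) p u v *m T p) (w *m T p)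
    =
  (rdot (v *m DT u) (w *m T p) + rdot (v *m T p) (w *m DT u - u *m DT w))
  + (rdot (u *m DT v) (w *m T p) + rdot (u *m T p) (w *m DT v - v *m DT w)).
Proof.
move=> DTlin Tu hT; rewrite -form_eval_frame.
pose DG a : 'M[R]_N := DT a *m (T p)^T + T p *m (DT a)^T.
have DGlin : linear DG.
  move=> c a b; rewrite /DG DTlin mulmxDl linearD mulmxDr linearZ /=.
  by rewrite -scalemxAl -scalemxAr scalerDr addrACA.
pose DGf := GRing.isLinear.Build R 'rV[R]_N 'M[R]_N _ DG DGlin.
pose DGl : {linear 'rV[R]_N -> 'M[R]_N} := HB.pack DG DGf.
have E a b c : form_eval (DG a) b c = rdot (b *m DT a) (c *m T p)
    + rdot (b *m T p) (c *m DT a).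
  rewrite /form_eval /DG /rdot mulmxDr mulmxDl mxE !trmx_mul !mulmxA //.
rewrite (@koszul_formula _ _ _ DGl p u v w).
- rewrite !E !rdotDr !rdotNr (rdotC (v *m T p) (u *m DT w)); ring.
- by rewrite trmx_mul trmxK.
- by rewrite unitmx_mul unitmx_tr Tu.
- move=> i; apply: mx_deriveM; first exact: hT.
  exact: (mx_derive_linear trmx (hT i)).
Qed.

End RowDot.

(** * A criterion for vanishing mean curvature *)

Section MeanCurvatureFacts.
Variables (R : realType) (N P : nat).
Variables (G : 'rV[R]_P -> 'M[R]_P) (phi : 'rV[R]_P -> R).
Variable F : 'rV[R]_N -> 'rV[R]_P.

Lemma induced_metric_sym x :
  (G (F x))^T = G (F x) -> (induced_metric G F x)^T = induced_metric G F x.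
Proof.
move=> Gs; apply/matrixP => i j; rewrite mxE.
by rewrite [LHS]mxE [RHS]mxE; apply: form_evalC.
Qed.

(** Both projections are linear, so they can be applied after taking the trace. The first one kills
    the gradient and fixes the vectors [push F k x], and the second one kills these. *)
Lemma mean_curvature_vector_eq0 x c (t : 'I_N -> R) :
  (G (F x))^T = G (F x) -> induced_metric G F x \in unitmx ->
  (forall k, form_eval (G (F x)) (push F k x) (grad G phi (F x)) = 0) ->
  form_eval (G (F x)) (grad G phi (F x)) (grad G phi (F x)) != 0 ->
  \sum_i \sum_j invmx (induced_metric G F x) i j *: nabla_along G F i j x
    = c *: grad G phi (F x) + \sum_k t k *: push F k x ->
  mean_curvature_vector G phi F x = 0.
Proof.
set h := induced_metric G F x; set gr := grad G phi (F x) => Gs hu gort gn0 hT.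
have np_lin : linear (normal_proj G F x).
  move=> a u v; rewrite /normal_proj scalerBr addrACA -opprD; congr (_ - _).
  rewrite scaler_sumr -big_split; apply: eq_bigr => i _ /=.
  rewrite scaler_sumr -big_split; apply: eq_bigr => j _ /=.
  by rewrite scalerA -scalerDl form_evalP; congr (_ *: _); ring.
have hp_lin : linear (hypersurface_proj G phi (F x)).
  move=> a u v; rewrite /hypersurface_proj scalerBr addrACA -opprD.
  congr (_ - _); rewrite scalerA -scalerDl form_evalP; congr (_ *: _); ring.
pose npl : {linear _ -> _} := HB.pack (normal_proj G F x)
  (GRing.isLinear.Build R 'rV[R]_P 'rV[R]_P _ _ np_lin).
pose hpl : {linear _ -> _} := HB.pack (hypersurface_proj G phi (F x))
  (GRing.isLinear.Build R 'rV[R]_P 'rV[R]_P _ _ hp_lin).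
rewrite /mean_curvature_vector -/h.
have -> : \sum_i \sum_j invmx h i j *: second_fundamental_form G phi F i j x
    = npl (hpl (\sum_i \sum_j invmx h i j *: nabla_along G F i j x)).
  rewrite !linear_sum; apply: eq_bigr => i _; rewrite !linear_sum.
  by apply: eq_bigr => j _; rewrite !linearZ.
have hs : h^T = h by exact: induced_metric_sym.
have hpgr : hpl gr = 0 by rewrite /= /hypersurface_proj divff // scale1r subrr.
have hpk k : hpl (push F k x) = push F k x.
  by rewrite /= /hypersurface_proj gort mul0r scale0r subr0.
rewrite hT (linearD hpl) (linearZ_LR hpl) hpgr scaler0 add0r (linear_sum hpl)
  (linear_sum npl).
rewrite big1 ?scaler0 // => k _.
rewrite (linearZ_LR hpl) hpk (linearZ_LR npl);
  suff -> : npl (push F k x) = 0 by rewrite scaler0.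
rewrite /=.
rewrite /normal_proj (eq_bigr (fun i => (k == i)%:R *: push F i x)) => [|i _].
  rewrite (bigD1 k) //= eqxx scale1r big1 ?addr0 ?subrr // => i ik.
  by rewrite eq_sym (negPf ik) scale0r.
rewrite -scaler_suml; congr (_ *: _).
transitivity ((h *m invmx h) k i); last by rewrite mulmxV // mxE.
rewrite mxE; apply: eq_bigr => j _.
rewrite mulrC; congr (_ * _); first by rewrite /h mxE.
by rewrite -[in RHS]hs -trmx_inv mxE.
Qed.

End MeanCurvatureFacts.

(** * Left-invariant connections on a group in a global chart *)

(* Row vectors hold components in a left-invariant frame: v *m theta x are the
   components of the tangent vector v at x.  For left-invariant a and b,
   b *m Lam a is the covariant derivative of b along a, and b *m Psi a the
   derivative of b along a in the coordinates. *)
Section LeftInvariantFrame.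
Variables (R : realType) (N : nat).
Variables (theta L : 'rV[R]_N -> 'M[R]_N).
Variables (Psi Lam : {linear 'rV[R]_N -> 'M[R]_N}).

Hypothesis thetaL : forall x, theta x *m L x = 1%:M.
Hypothesis dtheta : forall x u,
  mx_derive theta x u (- (theta x *m Psi (u *m theta x))).
Hypothesis dL : forall x u, mx_derive L x u (Psi (u *m theta x) *m L x).
(** This and the next three hypotheses say: [Lam] is metric; it has the same brackets as the
    torsion-free connection [Psi]; [Psi] is flat; the sum of the covariant derivatives of the [e_k]
    along themselves is zero, which amounts to unimodularity. *)
Hypothesis Lam_skew : forall a, (Lam a)^T = - Lam a.
Hypothesis Lam_torsion : forall a b,
  b *m Lam a - a *m Lam b = b *m Psi a - a *m Psi b.
Hypothesis Psi_flat : forall a b,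
  Psi (b *m Psi a - a *m Psi b) = Psi b *m Psi a - Psi a *m Psi b.
Hypothesis Lam_div : \sum_k basis_vec R k *m Lam (basis_vec R k) = 0.

Implicit Types (a b c u v w x : 'rV[R]_N).

Let g x : 'M[R]_N := theta x *m (theta x)^T.

Let Ltheta x : L x *m theta x = 1%:M.
Proof. exact: mulmx1C. Qed.

Let theta_unit x : theta x \in unitmx.
Proof. by case: (mulmx1_unit (thetaL x)). Qed.

Let thetaK x m (A : 'M[R]_(m, N)) : A *m theta x *m L x = A.
Proof. by rewrite -mulmxA thetaL mulmx1. Qed.

Let LK x m (A : 'M[R]_(m, N)) : A *m L x *m theta x = A.
Proof. by rewrite -mulmxA Ltheta mulmx1. Qed.

Let lam_skew a b c : rdot (b *m Lam a) c = - rdot b (c *m Lam a).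
Proof. by rewrite rdot_mul Lam_skew mulmxN rdotNr. Qed.

Let lam_skew0 a b : rdot (b *m Lam a) b = 0.
Proof.
have := lam_skew a b b; rewrite (rdotC b) => /eqP.
by rewrite -addr_eq0 -mulr2n mulrn_eq0 => /eqP.
Qed.

(** The difference tensor of two torsion-free connections, hence symmetric; it represents
    [christoffel_form] in the frame. *)
Let Pi a : 'M[R]_N := Lam a - Psi a.

Let Pi_sym a b : b *m Pi a = a *m Pi b.
Proof.
have e : b *m Lam a = b *m Psi a - a *m Psi b + a *m Lam b.
  by rewrite -Lam_torsion subrK.
by rewrite /Pi !mulmxBr e addrAC (addrAC (b *m Psi a)) subrr add0r addrC.
Qed.

Lemma christoffel_left_invariant x u v :
  christoffel_form g x u v *m theta x = v *m theta x *m Pi (u *m theta x).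
Proof.
apply: rdot_inj => c; rewrite -(LK x c); set w := c *m L x.
pose DT a := - (theta x *m Psi (a *m theta x)).
have DTlin : linear DT.
  move=> r a b; rewrite /DT mulmxDl -scalemxAl linearP mulmxDr -scalemxAr.
  by rewrite opprD scalerN.
have := @koszul_frame _ _ theta DT x u v w DTlin (theta_unit x)
  (fun i => dtheta x (basis_vec R i)).
rewrite -/(g) /DT !mulmxN !mulmxA !(rdotDr, rdotNl, rdotNr) !opprK.
set a := u *m _; set b := v *m _; set d := w *m _.
rewrite mulmxBr rdotDl rdotNl.
have tf a' b' c' : rdot (b' *m Lam a') c' - rdot (a' *m Lam b') c'
    = rdot (b' *m Psi a') c' - rdot (a' *m Psi b') c'.
  by rewrite -!rdotNl -!rdotDl Lam_torsion.
have sk a' b' c' : rdot (b' *m Lam a') c' = - rdot (c' *m Lam a') b'.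
  by rewrite lam_skew rdotC.
(* Uniqueness of the Levi-Civita connection: three instances of the torsion identity and three of
   skewness determine the pairing linearly. *)
have := tf a b d; have := tf a d b; have := tf b d a.
have := sk a b d; have := sk b a d; have := sk d a b.
rewrite (rdotC b (d *m Psi a)) (rdotC b (a *m Psi d)).
rewrite (rdotC a (d *m Psi b)) (rdotC a (b *m Psi d)).
lra.
Qed.

Lemma derive_left_invariant a b x :
  'D_(a *m L x) (fun y => b *m L y) x = b *m Psi a *m L x.
Proof.
have h := mx_deriveM (mx_derive_cst b x (a *m L x)) (dL x (a *m L x)).
by have [_ ->] := mx_derive_row h; rewrite mul0mx add0r LK mulmxA.
Qed.

Lemma nabla_left_invariant a b :
  nabla g (fun x => a *m L x) (fun x => b *m L x) = fun x => b *m Lam a *m L x.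
Proof.
apply/funext => x; rewrite /nabla derive_left_invariant.
rewrite -[christoffel_form _ _ _ _](thetaK x) christoffel_left_invariant !LK.
by rewrite -mulmxDl -mulmxDr addrC subrK.
Qed.

Lemma lie_bracket_left_invariant a b :
  lie_bracket (fun x => a *m L x) (fun x => b *m L x)
  = fun x => (b *m Psi a - a *m Psi b) *m L x.
Proof.
by apply/funext => x; rewrite /lie_bracket !derive_left_invariant mulmxBl.
Qed.

Lemma curvature_left_invariant a b c x :
  curvature g (fun x => a *m L x) (fun x => b *m L x) (fun x => c *m L x) x
  = (c *m Lam b *m Lam a - c *m Lam a *m Lam b
     - c *m Lam (b *m Psi a - a *m Psi b)) *m L x.
Proof.
by rewrite /curvature lie_bracket_left_invariant !nabla_left_invariant !mulmxBl.
Qed.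

Lemma shape_op_left_invariant a b :
  shape_op g (fun x => a *m L x) (fun x => b *m L x)
  = fun x => (- (a *m Lam b)) *m L x.
Proof.
by apply/funext => x; rewrite /shape_op nabla_left_invariant mulNmx.
Qed.

(** Both conditions are read at the point 0. In the first, the term [A_V (nabla_(e_i) e_i)] sums to
    zero by [Lam_div], and [s] is [- |A_V|^2]. The second is negated because [A_V e_i] is minus the
    covariant derivative of [V]. *)
Lemma harmonic_left_invariant nu :
  defines_harmonic_map g (fun i x => basis_vec R i *m L x) (fun x => nu *m L x)
    ->
  (exists s : R,
    \sum_i nu *m Lam (basis_vec R i) *m Lam (basis_vec R i) = s *: nu) /\
  \sum_i (basis_vec R i *m Lam (nu *m Lam (basis_vec R i)) *m Lam nu
          - basis_vec R i *m Lam nu *m Lam (nu *m Lam (basis_vec R i))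
          - basis_vec R i *m Lam (nu *m Lam (basis_vec R i) *m Psi nu
                                  - nu *m Psi (nu *m Lam (basis_vec R i)))) = 0.
Proof.
move=> [_ /(_ 0) h1 /(_ 0) h2].
have inj (A B : 'rV[R]_N) : A *m L 0 = B *m L 0 -> A = B.
  by move=> h; rewrite -(LK 0 A) h LK.
split.
- exists (- shape_op_norm2 g (fun i x => basis_vec R i *m L x)
      (fun x => nu *m L x) 0).
  apply: inj; rewrite -scalemxAl scaleNr -h1 mulmx_suml.
  under [in RHS]eq_bigr => i _ do rewrite /nabla_shape_op
    shape_op_left_invariant
    !nabla_left_invariant shape_op_left_invariant -mulmxBl opprK mulNmx mulmxDl
      mulNmx.
  rewrite big_split sumrN /= opprD opprK -[LHS]addr0; congr (_ + _).
  rewrite -mulmx_suml -mulmx_sumr.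
  by rewrite -(linear_sum Lam) Lam_div (linear0 Lam) mulmx0 mul0mx oppr0.
- apply: inj; apply: oppr_inj; rewrite mul0mx oppr0 -[RHS]h2 mulmx_suml -sumrN.
  apply: eq_bigr => i _;
    rewrite shape_op_left_invariant curvature_left_invariant.
  rewrite -mulNmx; congr (_ *m _); set B := nu *m Lam _.
  have -> : - B *m Psi nu - nu *m Psi (- B) = - (B *m Psi nu - nu *m Psi B).
    by rewrite (linearN Psi) mulmxN mulNmx opprK opprB addrC.
  by rewrite !(linearN Lam) !mulmxN mulNmx !opprD !opprK.
Qed.

(** * The Sasaki metric along a left-invariant unit field, and its minimality *)

Section Minimal.
Variable nu : 'rV[R]_N.
Hypothesis nu1 : rdot nu nu = 1.

Let V x := nu *m L x.

(* Components in the orthonormal frame of horizontal and vertical lifts. *)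
Let TH (q : 'rV[R]_(N + N)) : 'M[R]_(N + N) :=
  let t := theta (lsubmx q) in block_mx t (t *m Pi (rsubmx q *m t)) 0 t.

Let sasaki_metricE : sasaki_metric g = fun q => TH q *m (TH q)^T.
Proof.
apply/funext => q; apply/matrixP => i j; rewrite mxE -rdot_delta /sasaki_form.
have E (w : 'rV[R]_(N + N)) : sasaki_D g q w *m theta (lsubmx q) =
    lsubmx w *m theta (lsubmx q) *m Pi (rsubmx q *m theta (lsubmx q))
    + rsubmx w *m theta (lsubmx q).
  by rewrite mulmxDl christoffel_left_invariant addrC.
rewrite !form_eval_frame !E -rdot_row /TH.
rewrite -[in RHS](hsubmxK (delta_mx 0 i)) -[in RHS](hsubmxK (delta_mx 0 j)).
by rewrite !mul_row_block !mulmx0 !addr0 !mulmxA.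
Qed.

Let TH_unit q : TH q \in unitmx.
Proof.
rewrite /TH; set t := theta _; set l := L (lsubmx q); set P := Pi _.
apply: (proj1 (@mulmx1_unit _ _ _ (block_mx l (- (P *m l)) 0 l) _)).
rewrite mulmx_block !mulmx0 !mul0mx !addr0 !add0r mulmxN mulmxA addNr thetaL.
by rewrite -scalar_mx_block.
Qed.

Let DTH q (w : 'rV[R]_(N + N)) : 'M[R]_(N + N) :=
  let t := theta (lsubmx q) in
  let a := lsubmx w *m t in
  let n := rsubmx q *m t in
  block_mx (- (t *m Psi a))
    (- (t *m Psi a *m Pi n) + t *m Pi (rsubmx w *m t - n *m Psi a))
    0 (- (t *m Psi a)).

Let Pi_lin : linear Pi.
Proof.
by move=> r a b; rewrite /Pi (linearP Lam) (linearP Psi) opprD addrACA scalerBr.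
Qed.

Let dTH q (w : 'rV[R]_(N + N)) : mx_derive TH q w (DTH q w).
Proof.
have ht : mx_derive (fun y => theta (lsubmx y)) q w
    (- (theta (lsubmx q) *m Psi (lsubmx w *m theta (lsubmx q)))).
  exact: (@mx_derive_precomp _ _ _ _ _ lsubmx _ _ _ _ (dtheta _ _)).
have hr : mx_derive rsubmx q w (rsubmx w).
  exact: (mx_derive_linear rsubmx (mx_derive_id q w)).
pose Pil : {linear 'rV[R]_N -> 'M[R]_N} := HB.pack Pi
  (GRing.isLinear.Build R 'rV[R]_N 'M[R]_N _ _ Pi_lin).
have hn := mx_deriveM hr ht.
have hp := mx_derive_linear Pil hn.
have := mx_derive_block ht (mx_deriveM ht hp) (mx_derive_cst 0 q w) ht.
rewrite /DTH /= mulNmx mulmxN !mulmxA; exact.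
Qed.

Let DTH_lin q : linear (DTH q).
Proof.
move=> r u v; rewrite /DTH /=; set t := theta _; set n := rsubmx q *m t.
have -> : lsubmx (r *: u + v) *m t = r *: (lsubmx u *m t) + lsubmx v *m t.
  by rewrite linearP mulmxDl -scalemxAl.
have -> : rsubmx (r *: u + v) *m t = r *: (rsubmx u *m t) + rsubmx v *m t.
  by rewrite linearP mulmxDl -scalemxAl.
set a1 := lsubmx u *m t; set a2 := lsubmx v *m t.
set k1 := rsubmx u *m t; set k2 := rsubmx v *m t.
have e1 : Psi (r *: a1 + a2) = r *: Psi a1 + Psi a2 by rewrite linearP.
have e2 : r *: k1 + k2 - n *m Psi (r *: a1 + a2) =
    r *: (k1 - n *m Psi a1) + (k2 - n *m Psi a2).
  by rewrite e1 mulmxDr -scalemxAr opprD addrACA scalerBr.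
rewrite e2 Pi_lin e1 scale_block_mx add_block_mx scaler0 addr0.
move: (Pi n) (Pi (k1 - _)) (Pi (k2 - _)) => Pn P1 P2.
congr block_mx; rewrite !(mulmxDr, mulmxDl) -?scalemxAr -?scalemxAl.
- by rewrite opprD scalerN.
- by rewrite opprD scalerDr scalerN addrACA.
- by rewrite opprD scalerN.
Qed.

Let nuL x : nu *m L x *m theta x = nu. Proof. exact: LK. Qed.

Let push_V j : push (section_map V) j =
  fun x => row_mx (basis_vec R j) (nu *m Psi (basis_vec R j *m theta x) *m L x).
Proof.
apply/funext => x; rewrite /push.
have h := mx_deriveM (mx_derive_cst nu x (basis_vec R j)) (dL x (basis_vec R
  j)).
have := mx_derive_row_mx (mx_derive_id x (basis_vec R j)) h.
by rewrite mul0mx add0r mulmxA => /mx_derive_row[_ ->].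
Qed.

Let dpush_V i j x (a := fun i => basis_vec R i *m theta x) :
  'D_(basis_vec R i) (push (section_map V) j) x = row_mx 0
    ((nu *m Psi (a j) *m Psi (a i) - nu *m Psi (a j *m Psi (a i))) *m L x).
Proof.
rewrite push_V.
have h1 := mx_deriveM (mx_derive_cst (basis_vec R j) x (basis_vec R i))
  (dtheta x (basis_vec R i)).
have h2 := mx_deriveM (mx_derive_cst nu x (basis_vec R i))
  (mx_derive_linear Psi h1).
have h3 := mx_deriveM h2 (dL x (basis_vec R i)).
have := mx_derive_row_mx (mx_derive_cst (basis_vec R j) x (basis_vec R i)) h3.
move=> /mx_derive_row[_ ->]; congr row_mx.
rewrite !mul0mx !add0r mulmxN (linearN Psi) mulmxN mulmxBl mulmxA mulNmx.
by rewrite [RHS]addrC mulmxA.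
Qed.

Let section_l x : lsubmx (section_map V x) = x. Proof. exact: row_mxKl. Qed.

Let section_r x : rsubmx (section_map V x) *m theta x = nu.
Proof. by rewrite row_mxKr nuL. Qed.

Let mulTH x (h k : 'rV[R]_N) : row_mx h k *m TH (section_map V x) =
  row_mx (h *m theta x) (h *m theta x *m Pi nu + k *m theta x).
Proof.
by rewrite /TH section_l section_r mul_row_block mulmx0 addr0 mulmxA.
Qed.

(** [y] measures the failure of [w] to be tangent to the image of [V]; it vanishes when [w] is a
    push-forward. *)
Let mulDTH x (h k : 'rV[R]_N) (w : 'rV[R]_(N + N)) (a := lsubmx w *m theta x)
    (y := rsubmx w *m theta x - nu *m Psi a) :
  row_mx h k *m DTH (section_map V x) w =
  row_mx (- (h *m theta x *m Psi a))
    (- (h *m theta x *m Psi a *m Pi nu) + h *m theta x *m Pi y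
     - k *m theta x *m Psi a).
Proof.
rewrite /DTH section_l section_r mul_row_block mulmx0 addr0.
by rewrite mulmxDr !mulmxN !mulmxA.
Qed.

(** [dV(X)] is the horizontal lift of [X] plus the vertical lift of the covariant derivative of [V]
    along [X]: the coordinate derivative [Psi] and the Christoffel part [Pi] add up to [Lam]. *)
Let pushTH j x (a := basis_vec R j *m theta x) :
  push (section_map V) j x *m TH (section_map V x) = row_mx a (nu *m Lam a).
Proof.
by rewrite push_V mulTH -/a LK Pi_sym /Pi mulmxBr subrK.
Qed.

(** Skewness of [Lam] removes the horizontal part, so the gradient of the squared norm is twice the
    vertical lift of [nu]. *)
Let sq_norm_partial x k : partial k (sq_norm g) (section_map V x) =
  2 * rdot (row_mx 0 nu) (delta_mx 0 k *m TH (section_map V x)).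
Proof.
set q := section_map V x; set w : 'rV[R]_(N + N) := delta_mx 0 k.
have ht : mx_derive (fun y => theta (lsubmx y)) q w
    (- (theta (lsubmx q) *m Psi (lsubmx w *m theta (lsubmx q)))).
  exact: (@mx_derive_precomp _ _ _ _ _ lsubmx _ _ _ _ (dtheta _ _)).
have hr : mx_derive rsubmx q w (rsubmx w).
  exact: (mx_derive_linear rsubmx (mx_derive_id q w)).
have hn := mx_deriveM hr ht.
have := mx_deriveM hn (mx_derive_linear trmx hn) 0 0.
rewrite /partial => -[_].
have -> : sq_norm g = (fun y : 'rV[R]_(N + N) =>
   (rsubmx y *m theta (lsubmx y) *m (rsubmx y *m theta (lsubmx y))^T) 0 0).
  by apply/funext => y; rewrite /sq_norm form_eval_frame.
move=> ->; rewrite section_l section_r.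
rewrite -[w](hsubmxK w) mulTH row_mxKl row_mxKr rdot_row rdot0l add0r.
rewrite mxE -/(rdot _ _) -/(rdot _ _) (rdotC nu) mulmxN mulmxA section_r.
set a := lsubmx w *m _; rewrite (Pi_sym nu a) /Pi mulmxBr !rdotDr !rdotNr.
rewrite (rdotC nu (nu *m Lam a)) lam_skew0 rdotDl rdotNl (rdotC nu (rsubmx w *m
  _)) (rdotC nu (nu *m Psi _)).
ring.
Qed.

Let Nm : 'M[R]_N := \matrix_k (nu *m Lam (basis_vec R k)).

Let NmE b : b *m Nm = nu *m Lam b.
Proof.
rewrite mulmx_sum_row (linear_sum_basis Lam b) mulmx_sumr.
by apply: eq_bigr => k _; rewrite rowK scalemxAr.
Qed.

(* a *m Q holds the lift components of the image of a under dV. *)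
Let Q : 'M[R]_(N, N + N) := row_mx 1%:M Nm.

Let QE b : b *m Q = row_mx b (nu *m Lam b).
Proof. by rewrite mul_mx_row mulmx1 NmE. Qed.

Let pushQ j x : push (section_map V) j x *m TH (section_map V x) =
  basis_vec R j *m theta x *m Q.
Proof. by rewrite pushTH QE. Qed.

Let gradE x : grad (sasaki_metric g) (sq_norm g) (section_map V x) =
  2 *: row_mx 0 (nu *m L x).
Proof.
rewrite /grad; set q := section_map V x.
rewrite (_ : (\row_a partial a (sq_norm g) q)
   = (2 *: row_mx 0 (nu *m L x)) *m sasaki_metric g q).
  by rewrite mulmxK // sasaki_metricE unitmx_mul unitmx_tr TH_unit.
apply/rowP => k; rewrite mxE sq_norm_partial sasaki_metricE mulmxA.
rewrite -!scalemxAl [RHS]mxE mulTH !mul0mx add0r nuL.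
by rewrite /rdot trmx_mul trmx_delta mulmxA -colE mxE.
Qed.

(** [C] is the inner derivation sending [b] to the bracket of [b] and [a]; in an orthonormal basis
    its trace reduces to the sum in [Lam_div]. *)
Let bracket_trace (C : 'M[R]_N) a :
  (forall b, b *m C = a *m Psi b - b *m Psi a) -> \tr C = 0.
Proof.
move=> hC; rewrite /mxtrace (eq_bigr (fun k =>
  - rdot a (basis_vec R k *m Lam (basis_vec R k)))) => [|k _].
  rewrite sumrN (eq_bigr (fun k => rdot (basis_vec R k *m Lam (basis_vec R k))
    a)).
    by rewrite -rdot_suml Lam_div rdot0l oppr0.
  by move=> k _; rewrite rdotC.
transitivity (rdot (basis_vec R k *m C) (basis_vec R k)).
  by rewrite /rdot trmx_delta -colE -rowE !mxE.
by rewrite hC -Lam_torsion rdotDl rdotNl lam_skew0 subr0 lam_skew.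
Qed.

Let sum_tr (A B : 'M[R]_N) : \sum_i \sum_j A i j * B i j = \tr (A *m B^T).
Proof.
by apply: eq_bigr => i _; rewrite mxE; apply: eq_bigr => j _; rewrite mxE.
Qed.

(** In the left-invariant frame the induced metric is the constant matrix [Q *m Q^T], with inverse
    [H]. The trace of [nabla_along] is identified by pairing it with an arbitrary vector [w]. *)
Lemma minimal_left_invariant (H : 'M[R]_N) (c : R) :
  (1%:M + \matrix_(k, l) rdot (nu *m Lam (basis_vec R k))
                              (nu *m Lam (basis_vec R l))) *m H = 1%:M ->
  \sum_k \sum_l H k l *: (nu *m Lam (basis_vec R k) *m Lam (basis_vec R l))
    = c *: nu ->
  minimal_field g V.
Proof.
set M0 : 'M[R]_N := 1%:M + _ => hM hc x.
set q := section_map V x; pose a i := basis_vec R i *m theta x.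
have M0E : M0 = Q *m Q^T.
  rewrite /Q tr_row_mx mul_row_col trmx1 mulmx1 /M0; congr (_ + _).
  by apply/matrixP => k l; rewrite mxE -rdot_delta !NmE.
have M0s : M0^T = M0 by rewrite M0E trmx_mul trmxK.
have HM : H *m M0 = 1%:M by apply: mulmx1C.
have Hs : H^T = H.
  have e : H^T *m M0 = 1%:M by rewrite -[M0]M0s -trmx_mul hM trmx1.
  by rewrite -[LHS]mulmx1 -hM mulmxA e mul1mx.
have Gq (u v : 'rV[R]_(N + N)) : form_eval (sasaki_metric g q) u v = rdot (u *m
  TH q) (v *m TH q).
  by rewrite sasaki_metricE form_eval_frame.
have Gs : (sasaki_metric g q)^T = sasaki_metric g q.
  by rewrite sasaki_metricE trmx_mul trmxK.
set h := induced_metric (sasaki_metric g) (section_map V) x.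
have hE : h = theta x *m M0 *m (theta x)^T.
  apply/matrixP => i j; transitivity (rdot (a i *m Q) (a j *m Q)).
    by rewrite /h [LHS]mxE Gq; congr rdot; exact: pushQ.
  rewrite -!mulmxA rdot_delta.
  by rewrite M0E trmx_mul !mulmxA.
pose K := (L x)^T *m H *m L x.
have hK : h *m K = 1%:M.
  rewrite hE /K -!mulmxA (mulmxA (theta x)^T) -trmx_mul Ltheta trmx1 mul1mx.
  by rewrite (mulmxA M0) hM mul1mx thetaL.
have hu : h \in unitmx by case: (mulmx1_unit hK).
have hV : invmx h = K by rewrite -[LHS]mulmx1 -hK mulKmx.
have Ks : K^T = K by rewrite /K !trmx_mul trmxK Hs mulmxA.
(* A trace over coordinate fields with [K] equals the trace over the left-invariant frame with
   [H]. *)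
have Ktr B : \sum_i \sum_j K i j * rdot (a i *m B) (a j) =
    \sum_k \sum_l H k l * B k l.
  transitivity (\sum_i \sum_j K i j * (theta x *m B *m (theta x)^T) i j).
    apply: eq_bigr => i _; apply: eq_bigr => j _.
    by rewrite -rdot_delta mulmxA.
  rewrite !sum_tr !trmx_mul trmxK /K !mulmxA -(mulmxA _ (L x)) Ltheta mulmx1.
  by rewrite mxtrace_mulC !mulmxA -trmx_mul Ltheta trmx1 mul1mx.
(* The tangential part of the trace, as predicted by [puD] below. The normal part is [c] times the
   vertical lift of [nu], and [gradE] has a factor 2, whence [c / 2]. *)
pose T : 'rV[R]_N := - (\sum_i \sum_j K i j *: (a j *m Psi (a i))) *m L x.
apply: (@mean_curvature_vector_eq0 _ _ _ _ _ _ _ (c / 2) (fun k => T 0 k)) =>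
  //.
- move=> k; rewrite Gq gradE pushTH -scalemxAl mulTH !mul0mx add0r nuL.
  by rewrite rdotZr rdot_row rdotC rdot0l add0r lam_skew0 mulr0.
- rewrite Gq gradE -scalemxAl mulTH !mul0mx add0r nuL.
  rewrite rdotZr rdotZl rdot_row rdot0l add0r nu1 mulr1 mulf_neq0 ?pnatr_eq0 //.
rewrite -/h hV gradE scalerA divfK ?pnatr_eq0 //.
apply: (can_inj (mulmxK (TH_unit q))); apply: rdot_inj => om.
rewrite -[om](mulmxKV (TH_unit q)); set w := om *m _.
set al := lsubmx w *m theta x; set ka := rsubmx w *m theta x.
set ga := ka - nu *m Psi al.
(* [w] is split into [dV(al)] and the vertical lift of [ga]. *)
have wTH : w *m TH q = row_mx al (nu *m Lam al + ga).
  rewrite -[w](hsubmxK) mulTH -/al -/ka Pi_sym /Pi mulmxBr /ga.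
  by rewrite -addrA [- _ + _]addrC.
pose C : 'M[R]_N := \matrix_k (al *m Psi (basis_vec R k) - basis_vec R k *m Psi
  al).
have CE b : b *m C = al *m Psi b - b *m Psi al.
  have -> : b *m Psi al = \sum_k b 0 k *: (basis_vec R k *m Psi al).
    rewrite {1}(row_sum_delta b) mulmx_suml.
    by apply: eq_bigr => k _; rewrite scalemxAl.
  rewrite mulmx_sum_row (linear_sum_basis Psi b) mulmx_sumr -sumrB.
  by apply: eq_bigr => k _; rewrite rowK scalerBr scalemxAr.
pose E : 'M[R]_N := \matrix_k (ga *m Lam (basis_vec R k)).
have EE b : b *m E = ga *m Lam b.
  rewrite mulmx_sum_row (linear_sum_basis Lam b) mulmx_sumr.
  by apply: eq_bigr => k _; rewrite rowK scalemxAr.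
pose pu i := push (section_map V) i x.
have puE i : pu i = row_mx (basis_vec R i) (nu *m Psi (a i) *m L x).
  by rewrite /pu push_V.
have puga i : rsubmx (pu i) *m theta x - nu *m Psi (lsubmx (pu i) *m theta x) =
  0.
  by rewrite puE row_mxKl row_mxKr LK -/(a i) subrr.
have Pi0 : Pi 0 = 0 by rewrite /Pi (linear0 Lam) (linear0 Psi) subrr.
(* This is the derivative along [e_i] of the lift components [a j *m Q] of [dV(e_j)]: as [Q] is
   constant, only [theta] is differentiated and the result is tangent to the image of [V]. *)
have puD i j : pu j *m DTH q (pu i) + 'D_(basis_vec R i) (push (section_map V)
  j) x *m TH q
    = - (a j *m Psi (a i) *m Q).
  rewrite dpush_V mulTH {1}puE mulDTH puga Pi0 puE row_mxKl mulmx0 addr0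
    !mul0mx.
  rewrite !LK add0r add_row_mx addr0 QE -/(a i) -/(a j) opp_row_mx;
    congr row_mx.
  by rewrite addrA subrK Pi_sym /Pi mulmxBr opprB addrAC subrr add0r.
have wD i : w *m DTH q (pu i) - pu i *m DTH q w =
    - row_mx (a i *m C) (nu *m Lam (a i *m C) + ga *m Lam (a i)).
  have -> : w *m DTH q (pu i) = row_mx (- (al *m Psi (a i)))
      (- (al *m Psi (a i) *m Pi nu) - ka *m Psi (a i)).
    rewrite -[X in X *m _](hsubmxK w) mulDTH puga Pi0 mulmx0 addr0.
    by rewrite puE row_mxKl.
  have -> : pu i *m DTH q w = row_mx (- (a i *m Psi al))
      (- (a i *m Psi al *m Pi nu) + a i *m Pi ga - nu *m Psi (a i) *m Psi al).
    by rewrite puE mulDTH LK.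
  rewrite !opp_row_mx add_row_mx CE; congr row_mx;
    first by rewrite opprB opprK addrC.
  (* [Pi_sym] moves the bracket into the argument of [Pi]; flatness of [Psi] then rewrites its
     coordinate part as a commutator. *)
  have e1 : al *m Psi (a i) *m Pi nu - a i *m Psi al *m Pi nu =
      nu *m Lam (al *m Psi (a i) - a i *m Psi al)
      - (nu *m Psi al *m Psi (a i) - nu *m Psi (a i) *m Psi al).
    by rewrite -mulmxBl Pi_sym /Pi mulmxBr Psi_flat mulmxBr !mulmxA.
  have e2 : a i *m Pi ga = ga *m Lam (a i)
      - (ka *m Psi (a i) - nu *m Psi al *m Psi (a i)).
    by rewrite Pi_sym /Pi mulmxBr -mulmxBl.
  move: e1 e2; move: (al *m Psi (a i) *m Pi nu) (a i *m Psi al *m Pi nu)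
    (nu *m Lam _) (nu *m Psi al *m _) (nu *m Psi (a i) *m _) (a i *m Pi ga)
    (ga *m Lam _) (ka *m _) => v1 v2 v3 v4 v5 v6 v7 v8 e1 e2.
  apply/rowP => k; have := congr1 (fun M : 'rV_N => M 0 k) e1.
  have := congr1 (fun M : 'rV_N => M 0 k) e2; rewrite !mxE; lra.
(* One of the two halves of [koszul_frame]. *)
pose X i j := rdot (pu j *m DTH q (pu i)) (w *m TH q)
             + rdot (pu j *m TH q) (w *m DTH q (pu i) - pu i *m DTH q w).
pose D i j := rdot ('D_(basis_vec R i) (push (section_map V) j) x *m TH q) (w
  *m TH q).
have nab i j : rdot (nabla_along (sasaki_metric g) (section_map V) i j x *m TH
  q)
     (w *m TH q) = D i j + 2^-1 * (X i j + X j i).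
  rewrite /nabla_along mulmxDl rdotDl; congr (_ + _).
  apply: (@mulfI _ 2); rewrite ?pnatr_eq0 // mulrA divff ?pnatr_eq0 // mul1r.
  rewrite sasaki_metricE; exact: (@koszul_frame _ _ TH (DTH q) q (pu i) (pu j) w
    (DTH_lin q) (TH_unit q) (fun k => dTH q (basis_vec R k))).
have puQ j : pu j *m TH q = a j *m Q by exact: pushQ.
clearbody pu.
have DX i j : D i j + X i j = - rdot (a j *m Psi (a i) *m Q) (w *m TH q)
   - rdot (a i *m (C *m M0)) (a j) - rdot (a j *m (Nm *m E^T)) (a i).
  rewrite /D /X addrA -rdotDl [_ + pu j *m _]addrC puD rdotNl -addrA;
    congr (_ + _).
  rewrite puQ wD rdotNr QE rdot_row rdotDr addrA -rdot_row -!QE M0E.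
  rewrite opprD; congr (- _ - _).
    by rewrite rdotC !mulmxA [RHS]rdot_mul trmxK.
  by rewrite !mulmxA [RHS]rdot_mul trmxK NmE EE.
clearbody D X.
have Ksym i j : K i j = K j i by rewrite -[in LHS]Ks mxE.
have swap (f : 'I_N -> 'I_N -> R) :
    \sum_i \sum_j K i j * f i j = \sum_i \sum_j K i j * f j i.
  rewrite exchange_big; apply: eq_bigr => i _; apply: eq_bigr => j _.
  by rewrite Ksym.
(* As [K] is symmetric, the two halves of the Koszul formula have the same trace. *)
transitivity (\sum_i \sum_j K i j * (D i j + X i j)).
  transitivity (\sum_i \sum_j (K i j * (D i j + 2^-1 * X i j) + K i j * (2^-1 *
    X j i))).
    rewrite mulmx_suml rdot_suml; apply: eq_bigr => i _.
    rewrite mulmx_suml rdot_suml; apply: eq_bigr => j _.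
    by rewrite -scalemxAl rdotZl nab; ring.
  rewrite (eq_bigr _ (fun i _ => big_split _ _ _ _ _)) big_split /=.
  rewrite -(swap (fun i j => 2^-1 * X i j)) -big_split;
    apply: eq_bigr => i _ /=.
  by rewrite -big_split; apply: eq_bigr => j _ /=; field.
(* [H *m M0 = 1] leaves the trace of the inner derivation [C]. *)
have trC : \sum_i \sum_j K i j * rdot (a i *m (C *m M0)) (a j) = 0.
  rewrite Ktr sum_tr trmx_mul mulmxA M0s HM mul1mx mxtrace_tr.
  exact: (@bracket_trace C al).
(* The hypothesis on [H] and [c] enters here, after skewness has moved the second [Lam] from [ga] to
   the derivative of [nu]. *)
have trE : \sum_i \sum_j K i j * rdot (a i *m (Nm *m E^T)) (a j)
    = - rdot (c *: nu) ga.
  rewrite Ktr -hc rdot_suml -sumrN; apply: eq_bigr => k _.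
  rewrite rdot_suml -sumrN; apply: eq_bigr => l _.
  by rewrite -rdot_delta NmE EE rdotZl (lam_skew (basis_vec R l)) mulrN opprK.
transitivity (- (\sum_i \sum_j K i j * rdot (a j *m Psi (a i) *m Q) (w *m TH q))
    - (\sum_i \sum_j K i j * rdot (a i *m (C *m M0)) (a j))
    - (\sum_i \sum_j K i j * rdot (a i *m (Nm *m E^T)) (a j))).
  rewrite (swap (fun i j => rdot (a i *m (Nm *m E^T)) (a j))) -!sumrN
    -!big_split.
  apply: eq_bigr => i _ /=; rewrite -!sumrN -!big_split;
    apply: eq_bigr => j _ /=.
  by rewrite DX; ring.
rewrite trC trE subr0 opprK mulmxDl rdotDl addrC; congr (_ + _).
  rewrite -scalemxAl mulTH !mul0mx add0r nuL wTH !rdotZl rdot_row rdot0l add0r.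
  by rewrite [in RHS]rdotDr (rdotC nu (nu *m _)) lam_skew0 add0r.
rewrite mulmx_suml (eq_bigr (fun k => T 0 k *: basis_vec R k *m (theta x *m
  Q))).
  rewrite -mulmx_suml -row_sum_delta mulmxA /T LK mulNmx rdotNl; congr (- _).
  rewrite mulmx_suml rdot_suml; apply: eq_bigr => i _.
  rewrite mulmx_suml rdot_suml; apply: eq_bigr => j _.
  by rewrite -scalemxAl rdotZl.
by move=> k _; rewrite -!scalemxAl pushQ mulmxA.
Qed.

End Minimal.
End LeftInvariantFrame.

(** * The flat and the Levi-Civita connection of the oscillator group *)

Lemma linear_lin1_mx (R : realType) m k (F : 'rV[R]_m -> 'rV[R]_m -> 'rV[R]_k) :
  (forall b, linear (F^~ b)) -> linear (fun a => lin1_mx (F a)).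
Proof.
move=> h r a b; apply/matrixP => i j; rewrite !mxE.
by have := congr1 (fun M : 'rV_k => M 0 j) (h (delta_mx 0 i) r a b);
  rewrite /= !mxE.
Qed.

Section OscillatorFrame.
Variables (R : realType) (n : nat) (lambda : 'I_n -> R).
Local Notation point := ('rV[R]_(n + n + 2)).
Local Notation xi := (ord_xi n).
Local Notation pt := (@osc_point R n).
Local Notation zeta := (ord_zeta n).
Local Notation J := (osc_J lambda).
Implicit Types (a b c u v x : point) (p q : 'rV[R]_(n + n)).

(* Multiplication by i in C^n. *)
Definition osc_I p : 'rV[R]_(n + n) := row_mx (- rsubmx p) (lsubmx p).

Lemma osc_I_l p i : osc_I p 0 (lshift n i) = - p 0 (rshift n i).
Proof. by rewrite row_mxEl !mxE. Qed.

Lemma osc_I_r p i : osc_I p 0 (rshift n i) = p 0 (lshift n i).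
Proof. by rewrite row_mxEr !mxE. Qed.

Lemma osc_I_is_linear : linear osc_I.
Proof.
by move=> r p q; apply: row_lrP => i;
  rewrite [RHS]mxE [X in _ = X + _]mxE ?(osc_I_l, osc_I_r) !mxE ?mulrN ?opprD.
Qed.

HB.instance Definition _ := GRing.isLinear.Build R _ _ _ osc_I osc_I_is_linear.

Lemma osc_J_is_linear t : linear (J t).
Proof.
by move=> r p q; apply: row_lrP => i;
  rewrite [RHS]mxE [X in _ = X + _]mxE ?(osc_J_l, osc_J_r) !mxE; ring.
Qed.

HB.instance Definition _ t :=
  GRing.isLinear.Build R _ _ _ (J t) (osc_J_is_linear t).

Lemma osc_JP r s t p : J (r * s + t) p = r *: J s p + J t p.
Proof.
by apply: row_lrP => i;
  rewrite [RHS]mxE [X in _ = X + _]mxE ?(osc_J_l, osc_J_r); ring.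
Qed.

Lemma osc_JN t p : J (- t) p = - J t p.
Proof.
by apply: row_lrP => i; rewrite [RHS]mxE ?(osc_J_l, osc_J_r); ring.
Qed.

Lemma osc_omegaE p q : osc_omega p q = rdot (osc_I p) q.
Proof.
rewrite /rdot mxE big_split_ord /= -big_split /=; apply: eq_bigr => i _.
by rewrite [q^T _ _]mxE [q^T _ _]mxE osc_I_l osc_I_r; ring.
Qed.

Lemma osc_omega_J t p q : osc_omega (J t p) q = - osc_omega p (J t q).
Proof.
by rewrite -sumrN; apply: eq_bigr => i _; rewrite !osc_J_l !osc_J_r; ring.
Qed.

Lemma rdot_J t p q : rdot (J t p) q = - rdot p (J t q).
Proof.
rewrite /rdot !mxE !big_split_ord /= -!big_split -sumrN /=;
  apply: eq_bigr => i _.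
rewrite [q^T _ _]mxE [q^T _ _]mxE [(_ ^T) _ _]mxE [(_ ^T) _ _]mxE.
by rewrite !osc_J_l !osc_J_r; ring.
Qed.

Lemma osc_pointP u v : lsubmx u = lsubmx v -> u 0 xi = v 0 xi ->
  u 0 zeta = v 0 zeta -> u = v.
Proof. by move=> h1 h2 h3;
  rewrite -(osc_pointK u) -(osc_pointK v) h1 h2 h3. Qed.

Lemma osc_point_linear r p q s s' t t' :
  r *: osc_point p s t + osc_point q s' t' =
  osc_point (r *: p + q) (r * s + s') (r * t + t').
Proof.
apply: osc_pointP; first by rewrite linearP /= !lsubmx_osc_point.
- by rewrite osc_point_xi mxE [X in X + _ = _]mxE !osc_point_xi.
- by rewrite osc_point_zeta mxE [X in X + _ = _]mxE !osc_point_zeta.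
Qed.

Lemma osc_pointB p q s s' t t' :
  osc_point p s t - osc_point q s' t' = osc_point (p - q) (s - s') (t - t').
Proof.
by rewrite addrC -scaleN1r osc_point_linear !scaleN1r !mulN1r !(addrC (- _)).
Qed.

Lemma rdot_osc_point p q s s' t t' :
  rdot (osc_point p s t) (osc_point q s' t') = rdot p q + s * s' + t * t'.
Proof.
rewrite rdot_row -addrA; congr (_ + _).
by rewrite /rdot mxE big_ord_recl big_ord1 !mxE.
Qed.

(** Coordinate derivative at the unit, along [a], of the left-invariant field with value [b]. *)
Definition osc_flat a b : point :=
  osc_point (J (a 0 zeta) (lsubmx b)) (2^-1 * osc_omega (lsubmx a) (lsubmx b))
    0.

(** The Levi-Civita operator, as certified by [osc_lc_skew] and [osc_torsion]: [osc_flat] plus a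
    symmetric term coming from the Heisenberg brackets. *)
Definition osc_lc a b : point :=
  osc_point (J (a 0 zeta) (lsubmx b)
     - 2^-1 *: (a 0 xi *: osc_I (lsubmx b) + b 0 xi *: osc_I (lsubmx a)))
    (2^-1 * osc_omega (lsubmx a) (lsubmx b)) 0.

Lemma osc_omegaP r p q p' :
  osc_omega (r *: p + q) p' = r * osc_omega p p' + osc_omega q p'.
Proof. by rewrite !(osc_omegaC _ p') osc_omegaDr osc_omegaZr; ring. Qed.

Lemma osc_omegaBl p q p' :
  osc_omega (p - q) p' = osc_omega p p' - osc_omega q p'.
Proof. by rewrite addrC -scaleN1r osc_omegaP mulN1r addrC. Qed.

Lemma osc_flat_is_linear a : linear (osc_flat a).
Proof.
move=> r b c; rewrite /osc_flat osc_point_linear linearP (linearP (J _)) /=.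
by rewrite osc_omegaDr osc_omegaZr; congr osc_point; ring.
Qed.

HB.instance Definition _ a :=
  GRing.isLinear.Build R _ _ _ (osc_flat a) (osc_flat_is_linear a).

Lemma osc_lc_is_linear a : linear (osc_lc a).
Proof.
move=> r b c; rewrite /osc_lc osc_point_linear linearP (linearP (J _)) /=.
rewrite osc_omegaDr osc_omegaZr; congr osc_point; [|ring|ring].
apply/rowP => k; rewrite osc_I_is_linear !mxE; ring.
Qed.

HB.instance Definition _ a :=
  GRing.isLinear.Build R _ _ _ (osc_lc a) (osc_lc_is_linear a).

Lemma osc_flat_linear_l b : linear (osc_flat^~ b).
Proof.
suff h r u v : osc_flat (r *: u + v) b = r *: osc_flat u b + osc_flat v b.
  by move=> r u v; exact: h.
rewrite /osc_flat osc_point_linear (linearP lsubmx) osc_omegaP !mxE osc_JP.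
by congr osc_point; ring.
Qed.

Lemma osc_lc_linear_l b : linear (osc_lc^~ b).
Proof.
suff h r u v : osc_lc (r *: u + v) b = r *: osc_lc u b + osc_lc v b.
  by move=> r u v; exact: h.
rewrite /osc_lc osc_point_linear (linearP lsubmx) osc_omegaP osc_I_is_linear
  !mxE osc_JP.
congr osc_point; [|ring|ring].
move: (J _ _) (J _ _) (osc_I _) (osc_I _) (osc_I _) => p1 p2 p3 p4 p5.
by apply/rowP => k; rewrite !mxE; ring.
Qed.

Definition flat_mx a := lin1_mx (osc_flat a).
Definition lc_mx a := lin1_mx (osc_lc a).

HB.instance Definition _ := GRing.isLinear.Build R _ _ _ flat_mx
  (linear_lin1_mx osc_flat_linear_l).
HB.instance Definition _ := GRing.isLinear.Build R _ _ _ lc_mx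
  (linear_lin1_mx osc_lc_linear_l).

Lemma flat_mxE a b : b *m flat_mx a = osc_flat a b.
Proof. exact: mul_rV_lin1. Qed.

Lemma lc_mxE a b : b *m lc_mx a = osc_lc a b.
Proof. exact: mul_rV_lin1. Qed.

Lemma osc_lc_skew a b c : rdot (osc_lc a b) c = - rdot b (osc_lc a c).
Proof.
rewrite -{1}(osc_pointK c) -{2}(osc_pointK b) /osc_lc !rdot_osc_point.
rewrite !(rdotDl, rdotDr, rdotNl, rdotNr, rdotZl, rdotZr) rdot_J.
rewrite -!osc_omegaE !(rdotC (lsubmx b) (osc_I _)) -!osc_omegaE.
rewrite (osc_omegaC (lsubmx c) (lsubmx b)); ring.
Qed.

Lemma lc_mx_skew a : (lc_mx a)^T = - lc_mx a.
Proof.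
have e i j : rdot (osc_lc a (delta_mx 0 i)) (delta_mx 0 j) = lc_mx a i j.
  by rewrite -lc_mxE -[X in rdot _ X]mulmx1 rdot_delta trmx1 mulmx1.
by apply/matrixP => i j; rewrite [LHS]mxE [RHS]mxE -!e osc_lc_skew rdotC.
Qed.

Lemma osc_torsion a b : b *m lc_mx a - a *m lc_mx b = b *m flat_mx a - a *m
  flat_mx b.
Proof.
rewrite !lc_mxE !flat_mxE /osc_lc /osc_flat !osc_pointB; congr osc_point.
move: (J _ _) (J _ _) (osc_I _) (osc_I _) => p1 p2 p3 p4.
by apply/rowP => k; rewrite !mxE; ring.
Qed.

(** The maps [J t] commute and are skew for [osc_omega]. *)
Lemma flat_mx_flat a b :
  flat_mx (b *m flat_mx a - a *m flat_mx b)
  = flat_mx b *m flat_mx a - flat_mx a *m flat_mx b.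
Proof.
apply/row_matrixP => i; rewrite !rowE mulmxBr !mulmxA !flat_mxE.
move: (delta_mx 0 i) => v; apply/eqP; rewrite eq_sym; apply/eqP.
rewrite /osc_flat !osc_pointB.
rewrite !lsubmx_osc_point !osc_point_zeta; congr osc_point.
- by apply: row_lrP => k;
    rewrite [LHS]mxE [X in _ + X = _]mxE !(osc_J_l, osc_J_r); ring.
- by rewrite osc_omegaBl !osc_omega_J; ring.
- by ring.
Qed.

Lemma basis_vec_lshift j : basis_vec R (lshift 2 j) = pt (delta_mx 0 j) 0 0.
Proof.
apply/rowP => k; case: (split_ordP k) => i ->; rewrite ?row_mxEl ?row_mxEr !mxE.
  by rewrite (inj_eq (@lshift_inj _ _)).
by rewrite eq_rlshift; case: ifP.
Qed.

Let e_xi : basis_vec R xi = pt 0 1 0.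
Proof.
apply/rowP => k; case: (split_ordP k) => i ->; rewrite ?row_mxEl ?row_mxEr !mxE.
  by rewrite eq_lrshift.
by rewrite (inj_eq (@rshift_inj _ _)) /=; case: (i == ord0).
Qed.

Let e_zeta : basis_vec R zeta = pt 0 0 1.
Proof.
apply/rowP => k; case: (split_ordP k) => i ->; rewrite ?row_mxEl ?row_mxEr !mxE.
  by rewrite eq_lrshift.
rewrite (inj_eq (@rshift_inj _ _)); case: (unliftP ord_max i) => [i'|] -> //.
rewrite (ord1 i'); by have -> : lift ord_max ord0 = ord0 :> 'I_2 by
  apply/val_inj.
Qed.

Lemma sum_basis (T : nmodType) (F : point -> T) : \sum_k F (basis_vec R k) =
  \sum_j F (pt (delta_mx 0 j) 0 0) + (F (pt 0 1 0) + F (pt 0 0 1)).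
Proof.
rewrite big_split_ord big_ord_recl big_ord1 -e_xi -e_zeta;
  congr (_ + (_ + F _)).
  by apply: eq_bigr => j _; rewrite basis_vec_lshift.
Qed.

Lemma osc_lcE p q s s' t t' :
  osc_lc (osc_point p s t) (osc_point q s' t') =
  osc_point (J t q - 2^-1 *: (s *: osc_I q + s' *: osc_I p)) (2^-1 * osc_omega
    p q) 0.
Proof. by rewrite /osc_lc !lsubmx_osc_point !osc_point_xi !osc_point_zeta. Qed.

Lemma osc_omega0l q : osc_omega 0 q = 0 :> R.
Proof. by apply: big1 => i _; rewrite !mxE !mul0r subrr. Qed.

Lemma osc_omega_id p : osc_omega p p = 0 :> R.
Proof. by apply: big1 => i _; rewrite mulrC subrr. Qed.

Lemma osc_J0 q : J 0 q = 0.
Proof. by apply: row_lrP => i;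
  rewrite !(osc_J_l, osc_J_r) mxE !mul0r ?oppr0. Qed.

Lemma osc_point0 : pt 0 0 0 = 0.
Proof.
by apply: osc_pointP; rewrite ?lsubmx_osc_point ?osc_point_xi ?osc_point_zeta
  ?mxE ?linear0.
Qed.

(** Every term vanishes: the fields of the canonical frame are geodesic. *)
Lemma lc_mx_div : \sum_k basis_vec R k *m lc_mx (basis_vec R k) = 0.
Proof.
rewrite (sum_basis (fun v => v *m lc_mx v)) !lc_mxE big1 => [|j _].
  by rewrite !osc_lcE osc_omega0l !(linear0, scaler0, addr0, subr0, mulr0)
    osc_point0 !addr0.
by rewrite lc_mxE osc_lcE osc_omega_id osc_J0 !scale0r addr0 scaler0 subr0 mulr0
  osc_point0.
Qed.

Definition frame_mx x : 'M[R]_(n + n + 2) := lin1_mx (osc_lin lambda x).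
(** The differential of the translation by the inverse of [x], so that inverting the frame is a
    consequence of the group law. *)
Definition coframe_mx x : 'M[R]_(n + n + 2) :=
  lin1_mx (osc_lin lambda (osc_inv lambda x)).

Lemma coframe_frame x : coframe_mx x *m frame_mx x = 1%:M.
Proof.
apply: mulmx1C; apply/row_matrixP => k.
by rewrite !rowE mulmx1 mulmxA !mul_rV_lin1 /=; exact: osc_linK.
Qed.

Lemma osc_metricE : osc_metric lambda = fun x => coframe_mx x *m (coframe_mx
  x)^T.
Proof.
apply/funext => x; rewrite /osc_metric canonical_frame_mxE.
suff -> : invmx (lin1_mx (osc_lin lambda x)) = coframe_mx x by [].
have h := coframe_frame x; have [_ u] := mulmx1_unit h.
by rewrite -[LHS]mul1mx -h -mulmxA mulmxV ?mulmx1.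
Qed.

Lemma osc_rotJ s t p : osc_rot lambda s (J t p) = J t (osc_rot lambda s p).
Proof.
by apply: row_lrP => i;
  rewrite !(osc_rot_l, osc_rot_r, osc_J_l, osc_J_r); ring.
Qed.

Lemma osc_lin_invE x v : osc_lin lambda (osc_inv lambda x) v =
  osc_point (osc_rot lambda (- x 0 zeta) (lsubmx v))
    (v 0 xi - 2^-1 * osc_omega (lsubmx x) (lsubmx v)) (v 0 zeta).
Proof.
rewrite /osc_lin /osc_inv lsubmx_osc_point osc_point_zeta osc_omega_rot.
by rewrite -[X in osc_omega X]scaleN1r -[_ *: _]addr0 osc_omegaP osc_omega0l;
  congr osc_point; ring.
Qed.

Lemma frame_mx_derive x u :
  mx_derive frame_mx x u (flat_mx (u *m coframe_mx x) *m frame_mx x).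
Proof.
move=> i j; have := is_derive_mx (is_derive_osc_lin lambda x u (delta_mx 0 i))
  0 j.
have -> : (fun y => frame_mx y i j) = fun y => osc_lin lambda y (delta_mx 0 i)
  0 j.
  by apply/funext => y; rewrite /frame_mx mxE.
move/is_derive_eq; apply.
transitivity ((row i (flat_mx (u *m coframe_mx x) *m frame_mx x)) 0 j);
  last by rewrite mxE.
rewrite rowE mulmxA flat_mxE /frame_mx !mul_rV_lin1 /=;
  congr (fun_of_matrix _ _ _).
rewrite osc_lin_invE /osc_flat lsubmx_osc_point osc_point_zeta.
rewrite /osc_lin lsubmx_osc_point osc_point_xi osc_point_zeta.
congr osc_point; rewrite mulrDr; congr (_ + _); congr (_ * _).
by rewrite -[RHS](osc_omega_rot lambda (x 0 zeta)) -osc_rotD subrr osc_rot0.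
Qed.

Lemma coframe_mx_derive x u :
  mx_derive coframe_mx x u (- (coframe_mx x *m flat_mx (u *m coframe_mx x))).
Proof.
move=> i j; set v : point := delta_mx 0 i.
have -> : (fun y => coframe_mx y i j) = fun y => osc_lin lambda (osc_inv lambda
  y) v 0 j.
  by apply/funext => y; rewrite /coframe_mx mxE.
have -> : (- (coframe_mx x *m flat_mx (u *m coframe_mx x))) i j
    = (- osc_flat (u *m coframe_mx x) (v *m coframe_mx x)) 0 j.
  by rewrite -flat_mxE -mulmxA -rowE [LHS]mxE [RHS]mxE [X in _ = - X]mxE.
rewrite /coframe_mx !mul_rV_lin1 /= !osc_lin_invE /osc_flat !lsubmx_osc_point.
rewrite osc_point_zeta osc_omega_rot.
(* In the [C^n] components the translation by the inverse of [y] depends only on the [zeta]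
   coordinate, which is that of [- y]; the known derivative of [osc_lin] is therefore used at
   [- x]. *)
have hl k : is_derive x u (fun y => osc_lin lambda (osc_inv lambda y) v 0
  (lshift 2 k))
   (- J (u 0 zeta) (osc_rot lambda (- x 0 zeta) (lsubmx v)) 0 k).
  have := is_derive_mx (is_derive_osc_lin lambda (-1 *: x) (-1 *: u) v).
  move/(@mx_derive_precomp _ _ _ _ _ ( *:%R (-1)) (fun y => osc_lin lambda y
    v)).
  move/(_ 0 (lshift 2 k)).
  have -> : (fun y => osc_lin lambda (-1 *: y) v 0 (lshift 2 k)) =
     (fun y => osc_lin lambda (osc_inv lambda y) v 0 (lshift 2 k)).
    apply/funext => y; rewrite osc_lin_invE /osc_lin !osc_point_l.
    by congr (osc_rot _ _ _ 0 k); rewrite mxE mulN1r.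
  move/is_derive_eq; apply; rewrite osc_point_l.
  have -> : (-1 *: x) 0 zeta = - x 0 zeta by rewrite mxE mulN1r.
  have -> : (-1 *: u) 0 zeta = - u 0 zeta by rewrite mxE mulN1r.
  by rewrite osc_rotJ osc_JN mxE.
move: j; apply: osc_ordP => [k|k||].
- by apply: is_derive_eq (hl _) _; rewrite [RHS]mxE osc_point_l.
- by apply: is_derive_eq (hl _) _; rewrite [RHS]mxE osc_point_l.
- have h : mx_derive (fun y => osc_I (lsubmx y) *m (lsubmx v)^T) x u
      (osc_I (lsubmx u) *m (lsubmx v)^T).
    have := mx_deriveM (mx_derive_linear osc_I (mx_derive_linear lsubmx
      (mx_derive_id x u)))
       (mx_derive_cst (lsubmx v)^T x u).
    by rewrite mulmx0 addr0.
  have := is_deriveB (is_derive_cst (v 0 xi) x u) (is_deriveZ 2^-1 (h 0 0)).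
  have -> : (fun y => osc_lin lambda (osc_inv lambda y) v 0 xi) =
    cst (v 0 xi) - 2^-1 \*: (fun y => (osc_I (lsubmx y) *m (lsubmx v)^T) 0 0).
    by apply/funext => y; rewrite osc_lin_invE osc_point_xi osc_omegaE.
  by move/is_derive_eq; apply; rewrite [RHS]mxE osc_point_xi osc_omegaE sub0r.
- have -> : (fun y => osc_lin lambda (osc_inv lambda y) v 0 zeta) = cst (v 0
    zeta).
    by apply/funext => y; rewrite osc_lin_invE osc_point_zeta.
  by apply: is_derive_eq; rewrite [RHS]mxE osc_point_zeta oppr0.
Qed.

End OscillatorFrame.

(** * Equal structure constants: harmonicity and minimality in closed form *)

Section EqualLambda.
Variables (R : realType) (n : nat) (lambda : 'I_n -> R) (l : R).
Hypothesis lambdaE : forall i, lambda i = l.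
Local Notation point := ('rV[R]_(n + n + 2)).
Local Notation pt := (@osc_point R n).
Local Notation Lam := (lc_mx lambda).
Local Notation lc := (osc_lc lambda).
Local Notation I := (@osc_I R n).
Implicit Types (p q w : 'rV[R]_(n + n)).

Lemma osc_I_I p : I (I p) = - p.
Proof.
by apply: row_lrP => i; rewrite ?(osc_I_l, osc_I_r) mxE.
Qed.

Lemma rdot_I p q : rdot (I p) q = - rdot p (I q).
Proof. by rewrite -osc_omegaE osc_omegaC osc_omegaE rdotC. Qed.

Lemma rdot_II p q : rdot (I p) (I q) = rdot p q.
Proof. by rewrite rdot_I osc_I_I rdotNr opprK. Qed.

Lemma rdot_I_id p : rdot (I p) p = 0.
Proof. by rewrite -osc_omegaE osc_omega_id. Qed.

Lemma osc_JE t p : osc_J lambda t p = (t * l) *: I p.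
Proof.
by apply: row_lrP => i; rewrite [RHS]mxE ?(osc_J_l, osc_J_r, osc_I_l, osc_I_r)
  lambdaE ?mulrN.
Qed.

Lemma lcE p q s s' t t' : lc (pt p s t) (pt q s' t') =
  pt ((t * l - s / 2) *: I q - (s' / 2) *: I p) (2^-1 * rdot (I p) q) 0.
Proof.
rewrite osc_lcE osc_JE osc_omegaE; congr osc_point.
by apply/rowP => k; move: (I p) (I q) => p' q'; rewrite !mxE; field.
Qed.

Lemma osc_pointD p q s s' t t' : pt p s t + pt q s' t' = pt (p + q) (s + s') (t
  + t').
Proof. by have := osc_point_linear 1 p q s s' t t';
  rewrite !scale1r !mul1r. Qed.

Lemma osc_pointZ c p s t : c *: pt p s t = pt (c *: p) (c * s) (c * t).
Proof.
by have := osc_point_linear c p 0 s 0 t 0; rewrite osc_point0 !addr0.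
Qed.

Lemma osc_point_sum (K : finType) (p : K -> 'rV[R]_(n + n)) (s t : K -> R) :
  \sum_k pt (p k) (s k) (t k) = pt (\sum_k p k) (\sum_k s k) (\sum_k t k).
Proof.
apply: osc_pointP.
- rewrite linear_sum lsubmx_osc_point.
  by apply: eq_bigr => k _; rewrite /= lsubmx_osc_point.
- by rewrite summxE osc_point_xi; apply: eq_bigr => k _; rewrite osc_point_xi.
- by rewrite summxE osc_point_zeta; apply: eq_bigr => k _;
    rewrite osc_point_zeta.
Qed.

Lemma sum_rdot_delta q (f : {linear 'rV[R]_(n + n) -> 'rV[R]_(n + n)}) :
  \sum_j rdot (delta_mx 0 j) q *: f (delta_mx 0 j) = f q.
Proof.
rewrite [in RHS](row_sum_delta q) linear_sum; apply: eq_bigr => j _.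
by rewrite linearZ rdotC /rdot trmx_delta -colE mxE.
Qed.

Lemma rdot_delta_id (j : 'I_(n + n)) : rdot (delta_mx 0 j) (delta_mx 0 j) = 1
  :> R.
Proof. by rewrite /rdot trmx_delta mul_delta_mx mxE. Qed.

Let I0 : I 0 = 0. Proof. exact: linear0. Qed.

Let IZ c p : I (c *: p) = c *: I p. Proof. exact: linearZ. Qed.

Let IB p q : I (p - q) = I p - I q. Proof. exact: linearB. Qed.

Let IN p : I (- p) = - I p. Proof. exact: linearN. Qed.

Let rdot0r p : rdot p 0 = 0 :> R. Proof. by rewrite rdotC rdot0l. Qed.

Let simp0 := (mul0r, mulr0, subr0, sub0r, oppr0, scale0r, @scaler0, add0r,
  addr0,
  mul1r, I0, @rdot0l R (n + n), rdot0r).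

(** On [w] the directions of [C^n], [xi] and [zeta] contribute -1/4, -1/4 and [- l ^+ 2]; on [a]
    each of the [2n] directions of [C^n] contributes -1/4. *)
Lemma sum_lc_lc w a b :
  \sum_k pt w a b *m Lam (basis_vec R k) *m Lam (basis_vec R k) =
  pt (- (2^-1 + l ^+ 2) *: w) (- (n%:R / 2) * a) 0.
Proof.
rewrite (sum_basis (fun v => pt w a b *m Lam v *m Lam v)) !lc_mxE !lcE.
under eq_bigr => j _ do rewrite !lc_mxE !lcE !simp0 rdotNr rdotZr rdot_II
  rdot_delta_id rdot_I.
rewrite osc_point_sum !osc_pointD !simp0 !IZ !osc_I_I.
congr osc_point.
- have -> : \sum_j - ((2^-1 * - rdot (delta_mx 0 j) (I w) / 2) *: I (delta_mx 0
    j))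
      = 4^-1 *: I (I w).
    rewrite -(sum_rdot_delta (I w) I) scaler_sumr; apply: eq_bigr => j _.
    by rewrite scalerA -scaleNr; congr (_ *: _); field.
  by rewrite osc_I_I; apply/rowP => k; rewrite !mxE; field.
- by rewrite sumr_const card_ord -[_ *+ (n + n)]mulr_natr natrD; field.
- by rewrite big1.
Qed.

Lemma osc_flatE p q s s' t t' : osc_flat lambda (pt p s t) (pt q s' t') =
  pt ((t * l) *: I q) (2^-1 * rdot (I p) q) 0.
Proof.
by rewrite /osc_flat !lsubmx_osc_point osc_point_zeta osc_JE osc_omegaE.
Qed.

Let rdot_id_I p : rdot p (I p) = 0.
Proof. by rewrite rdotC rdot_I_id. Qed.

Let simpI := (IZ, IB, IN, osc_I_I, @rdotZl, @rdotZr, @rdotNl, @rdotNr,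
  rdot_I_id,
  rdot_id_I, @opprK).

(** The [C^n] component suffices to separate [w] from [a]. As multiples of [I w], the directions of
    [C^n] give [a/8 - a/4 - 2n a/8] in total, [xi] gives [a/8] and [zeta] gives 0. *)
Lemma sum_curvature w a (nu := pt w a 0) :
  lsubmx (\sum_i (basis_vec R i *m Lam (nu *m Lam (basis_vec R i)) *m Lam nu
          - basis_vec R i *m Lam nu *m Lam (nu *m Lam (basis_vec R i))
          - basis_vec R i *m Lam (nu *m Lam (basis_vec R i) *m flat_mx lambda nu
                      - nu *m flat_mx lambda (nu *m Lam (basis_vec R i)))))
  = - (n%:R * a / 4) *: I w.
Proof.
pose F v := v *m Lam (nu *m Lam v) *m Lam nu - v *m Lam nu *m Lam (nu *m Lam v)
   - v *m Lam (nu *m Lam v *m flat_mx lambda nu - nu *m flat_mx lambda (nu *m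
       Lam v)).
have Fxi : lsubmx (F (pt 0 1 0)) = (a / 8) *: I w.
  rewrite /F !(lc_mxE, flat_mxE) /nu !(lcE, osc_flatE) [X in lc X _]osc_pointB
    lcE.
  rewrite !osc_pointB lsubmx_osc_point !simp0 ?(simpI, simp0).
  by move: (I w) => p; apply/rowP => k; rewrite !mxE; field.
have Fzeta : lsubmx (F (pt 0 0 1)) = 0.
  rewrite /F !(lc_mxE, flat_mxE) /nu !(lcE, osc_flatE) [X in lc X _]osc_pointB
    lcE.
  by rewrite !osc_pointB lsubmx_osc_point !simp0 ?(simpI, simp0).
have Fp j (d := delta_mx 0 j : 'rV[R]_(n + n)) : lsubmx (F (pt d 0 0)) =
    (a / 8) *: (rdot d (I w) *: d) - (a / 4) *: (rdot d w *: I d) - (a / 8) *: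
      I w.
  rewrite /F !(lc_mxE, flat_mxE) /nu !(lcE, osc_flatE) [X in lc X _]osc_pointB
    lcE.
  rewrite !osc_pointB lsubmx_osc_point !simp0 ?(simpI, simp0).
  rewrite rdot_II (rdot_delta_id j : rdot d d = 1) (rdot_I d w) (rdotC (I w))
    (rdotC w).
  move: {Fxi Fzeta} d (rdot d (I w)) (rdot d w) (I d) (I w) => d x y p q.
  by apply/rowP => k; rewrite !mxE; field.
transitivity (lsubmx (\sum_j F (pt (delta_mx 0 j) 0 0) + (F (pt 0 1 0) + F (pt
  0 0 1)))).
  by congr lsubmx; exact: sum_basis.
clearbody F; rewrite 2!(linearD lsubmx) /= Fxi Fzeta addr0 (linear_sum lsubmx)
  /=.
rewrite (eq_bigr _ (fun j _ => Fp j)).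
rewrite sumrB sumrB -!scaler_sumr (sum_rdot_delta (I w) idfun) (sum_rdot_delta
  w I).
rewrite sumr_const card_ord /=.
by move: (I w) => p; apply/rowP => k;
  rewrite -[_ *+ (n + n)]scaler_nat !mxE natrD; field.
Qed.

Lemma rank1_entry (N : nat) (u v : 'rV[R]_N) k j :
  (u^T *m v) k j = rdot (basis_vec R k) u * rdot (basis_vec R j) v.
Proof.
by rewrite mxE big_ord1 mxE /rdot -!rowE !mxE.
Qed.

Lemma rank1_mul (N : nat) (u1 u2 v1 v2 : 'rV[R]_N) :
  u1^T *m u2 *m (v1^T *m v2) = rdot u2 v1 *: (u1^T *m v2).
Proof.
by rewrite mulmxA -(mulmxA u1^T) [u2 *m _]mx11_scalar mul_mx_scalar -scalemxAl.
Qed.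

(** A rank-one part of [H] contributes a single second covariant derivative of [nu], which makes the
    minimality criterion computable. *)
Lemma sum_rank1 (nu u v : point) :
  \sum_k \sum_j (u^T *m v) k j *: (nu *m Lam (basis_vec R k) *m Lam (basis_vec
    R j))
  = nu *m Lam u *m Lam v.
Proof.
rewrite (linear_sum_basis Lam u) mulmx_sumr mulmx_suml; apply: eq_bigr => k _.
rewrite (linear_sum_basis Lam v) mulmx_sumr; apply: eq_bigr => j _.
by rewrite mxE big_ord1 mxE -!scalemxAr -scalemxAl scalerA mulrC.
Qed.

Lemma sum_scalar (nu : point) :
  \sum_k \sum_j (1%:M : 'M[R]_(n + n + 2)) k j
     *: (nu *m Lam (basis_vec R k) *m Lam (basis_vec R j))
  = \sum_k nu *m Lam (basis_vec R k) *m Lam (basis_vec R k).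
Proof.
apply: eq_bigr => k _;
  rewrite (bigD1 k) //= mxE eqxx scale1r big1 ?addr0 // => j jk.
by rewrite mxE eq_sym (negPf jk) scale0r.
Qed.

Lemma sum_quad_linear (nu : point) c d (A B : 'M[R]_(n + n + 2)) :
  \sum_k \sum_j (c *: A + d *: B) k j
     *: (nu *m Lam (basis_vec R k) *m Lam (basis_vec R j))
  = c *: (\sum_k \sum_j A k j *: (nu *m Lam (basis_vec R k) *m Lam (basis_vec R
    j)))
   + d *: (\sum_k \sum_j B k j *: (nu *m Lam (basis_vec R k) *m Lam (basis_vec
     R j))).
Proof.
rewrite !scaler_sumr -big_split; apply: eq_bigr => k _ /=.
rewrite !scaler_sumr -big_split; apply: eq_bigr => j _ /=.
by rewrite !mxE scalerDl !scalerA.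
Qed.

(** The covariant derivative of [nu] along [x] has squared length [(x.u)^2 / 4 + (x.v)^2], with [u]
    and [v] orthogonal, so the induced metric is the identity plus two rank-one terms. *)
Lemma minimal_horizontal w : rdot w w = 1 ->
  minimal_field (osc_metric lambda) (fun x => pt w 0 0 *m frame_mx lambda x).
Proof.
move=> w1; rewrite osc_metricE.
set nu := pt w 0 0; pose u := pt (I w) 0 0; pose v := pt 0 (- 2^-1) l.
have uu : rdot u u = 1 by rewrite rdot_osc_point rdot_II w1; ring.
have uv : rdot u v = 0 by rewrite rdot_osc_point rdot0r; ring.
have vu : rdot v u = 0 by rewrite rdotC.
pose r := 4^-1 + l ^+ 2.
have r0 : 1 + r != 0.
  by apply: lt0r_neq0; rewrite /r; have := sqr_ge0 l; lra.
have vv : rdot v v = r by rewrite rdot_osc_point rdot0l /r; field.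
(* Inverse on the orthogonal lines of [u] and [v]: [1/5] is [(1/4) / (1 + 1/4)], and [r] is the
   squared length of [v]. In the factor of [nu], the second derivatives along [u] and [v] are
   [- w / 4] and [- r^2 w]. *)
apply: (@minimal_left_invariant _ _ _ _ (flat_mx lambda) Lam _ _ _ _ _ _ _ nu _
  (1 *: 1%:M + 1 *: (- 5^-1 *: (u^T *m u) + (- (1 + r)^-1) *: (v^T *m v)))
  (- (2^-1 + l ^+ 2) + 20^-1 + r ^+ 2 / (1 + r))).
- exact: coframe_frame.
- exact: coframe_mx_derive.
- exact: frame_mx_derive.
- exact: lc_mx_skew.
- exact: osc_torsion.
- exact: flat_mx_flat.
- exact: lc_mx_div.
- by rewrite rdot_osc_point w1; ring.
- have -> : \matrix_(k, j)
      rdot (nu *m Lam (basis_vec R k)) (nu *m Lam (basis_vec R j))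
    = 4^-1 *: (u^T *m u) + v^T *m v.
    apply/matrixP => k j; rewrite mxE [RHS]mxE [X in _ = X + _]mxE !rank1_entry.
    rewrite !lc_mxE -(osc_pointK (basis_vec R k)) -(osc_pointK (basis_vec R j)).
    move: (lsubmx _) (lsubmx _) => p q; rewrite !lcE !rdot_osc_point !simp0.
    rewrite !(simpI, simp0) !rdot_II ?w1.
    by rewrite (rdot_I p) (rdot_I q); field.
  have XX : u^T *m u *m (u^T *m u) = u^T *m u by rewrite rank1_mul uu scale1r.
  have XY : u^T *m u *m (v^T *m v) = 0 by rewrite rank1_mul uv scale0r.
  have YX : v^T *m v *m (u^T *m u) = 0 by rewrite rank1_mul vu scale0r.
  have YY : v^T *m v *m (v^T *m v) = r *: (v^T *m v) by rewrite rank1_mul vv.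
  rewrite !scale1r !(mulmxDl, mulmxDr) !(mulmx1, mul1mx) -!scalemxAl
    -!scalemxAr.
  rewrite XX XY YX YY; move: (u^T *m u) (v^T *m v) 1%:M => X Y Z.
  clear vv YY; move: r r0 => r r0.
  by apply/matrixP => i j; rewrite !mxE; field.
- rewrite sum_quad_linear sum_quad_linear sum_scalar !sum_rank1 sum_lc_lc
    !lc_mxE.
  rewrite /u /v /nu !lcE !simp0 ?(simpI, simp0) w1 !(osc_pointZ, osc_pointD).
  have -> : l * l - - 2^-1 / 2 = r by rewrite /r; field.
  clear uu uv vu vv; move: (2^-1 + l ^+ 2) r r0 => t r r0.
  by congr osc_point; [apply/rowP => k; rewrite !mxE; field | ring | ring].
Qed.

Lemma one_entry k j : (1%:M : 'M[R]_(n + n + 2)) k j = rdot (basis_vec R k)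
  (basis_vec R j).
Proof.
by rewrite -[basis_vec R k]mulmx1 -[basis_vec R j]mulmx1 rdot_delta trmx1
  mulmx1.
Qed.

(** Covers both [+-xi] and [+-zeta]. The covariant derivative of [nu] along [p] in [C^n] is
    [- (a / 2) I p], and it vanishes along [xi] and [zeta]; so the induced metric is [1 + t] on
    [C^n] and 1 on the other two axes. *)
Lemma minimal_vertical a b : a ^+ 2 + b ^+ 2 = 1 -> a * b = 0 ->
  minimal_field (osc_metric lambda) (fun x => pt 0 a b *m frame_mx lambda x).
Proof.
move=> ab1 ab0; rewrite osc_metricE.
set nu := pt 0 a b; pose u := pt 0 1 0; pose v := pt 0 0 1.
have uu : rdot u u = 1 by rewrite rdot_osc_point rdot0r; ring.
have vv : rdot v v = 1 by rewrite rdot_osc_point rdot0r; ring.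
have uv : rdot u v = 0 by rewrite rdot_osc_point rdot0r; ring.
have vu : rdot v u = 0 by rewrite rdotC.
pose t := a ^+ 2 / 4.
have t0 : 1 + t != 0.
  by apply: lt0r_neq0; rewrite /t; have := sqr_ge0 a; lra.
pose r := (1 + t)^-1.
apply: (@minimal_left_invariant _ _ _ _ (flat_mx lambda) Lam _ _ _ _ _ _ _ nu _
  (r *: 1%:M + 1 *: ((1 - r) *: (u^T *m u) + (1 - r) *: (v^T *m v)))
  (- (n%:R / 2) * r * a ^+ 2)).
- exact: coframe_frame.
- exact: coframe_mx_derive.
- exact: frame_mx_derive.
- exact: lc_mx_skew.
- exact: osc_torsion.
- exact: flat_mx_flat.
- exact: lc_mx_div.
- by rewrite rdot_osc_point rdot0r add0r -!expr2.
- have -> : \matrix_(k, j)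
      rdot (nu *m Lam (basis_vec R k)) (nu *m Lam (basis_vec R j))
    = t *: (1%:M - u^T *m u - v^T *m v).
    apply/matrixP => k j;
      rewrite mxE [RHS]mxE [X in _ * X]mxE [X in _ * (X + _)]mxE.
    rewrite [X in _ * (_ + X + _)]mxE [X in _ * (_ + X)]mxE !rank1_entry
      one_entry.
    rewrite !lc_mxE -(osc_pointK (basis_vec R k)) -(osc_pointK (basis_vec R j)).
    move: (lsubmx _) (lsubmx _) => p q; rewrite !lcE !rdot_osc_point !simp0.
    by rewrite !(simpI, simp0) !rdot_II /t; field.
  have XX : u^T *m u *m (u^T *m u) = u^T *m u by rewrite rank1_mul uu scale1r.
  have XY : u^T *m u *m (v^T *m v) = 0 by rewrite rank1_mul uv scale0r.
  have YX : v^T *m v *m (u^T *m u) = 0 by rewrite rank1_mul vu scale0r.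
  have YY : v^T *m v *m (v^T *m v) = v^T *m v by rewrite rank1_mul vv scale1r.
  rewrite scale1r !scalerBr !(mulmxDl, mulmxDr, mulNmx) -!scalemxAl -!scalemxAr.
  rewrite !(mulmx1, mul1mx) XX XY YX YY.
  move: (u^T *m u) (v^T *m v) 1%:M => X Y Z.
  rewrite /r; clear r; move: t t0 => t t0.
  by apply/matrixP => i j; rewrite !mxE; field.
- rewrite sum_quad_linear sum_quad_linear sum_scalar !sum_rank1 sum_lc_lc
    !lc_mxE.
  rewrite /u /v /nu !lcE !simp0 ?(simpI, simp0) !(osc_pointZ, osc_pointD).
  (* From [a b = 0] and [a^2 + b^2 = 1]; this lets one factor [c] serve both cases. *)
  rewrite !simp0; have a3 : a ^+ 3 = a.
    by rewrite -[RHS]mulr1 -ab1 mulrDr expr2 (expr2 b) !mulrA ab0; ring.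
  congr osc_point; first by rewrite -[in LHS]a3; ring.
  have -> : - (n%:R / 2) * r * a ^+ 2 * b = - (n%:R / 2) * r * a * (a * b) by
    ring.
  by rewrite ab0 mulr0.
Qed.

End EqualLambda.

(** * Reduction to the value at the unit and case distinction *)

Lemma left_invariantE (R : realType) n (lambda : 'I_n -> R) V :
  left_invariant lambda V -> V = fun x => V 0 *m frame_mx lambda x.
Proof.
move=> hV; apply/funext => x; have := hV x 0.
rewrite derive_osc_mul osc_mulE linear0 addr0 => <-.
by rewrite mul_rV_lin1.
Qed.

Lemma canonical_frame_left_mul (R : realType) n (lambda : 'I_n -> R) :
  canonical_frame lambda = fun k x => basis_vec R k *m frame_mx lambda x.
Proof.
by apply/funext => k; apply/funext => x; rewrite canonical_frameE mul_rV_lin1.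
Qed.

Theorem corollary3 (R : realType) (n : nat) (hn : (1 <= n)%N)
    (lambda : 'I_n -> R) (hlambda : forall i j : 'I_n, lambda i = lambda j)
    (V : 'rV[R]_(n + n + 2) -> 'rV[R]_(n + n + 2))
    (V_inv : left_invariant lambda V)
    (V_unit : unit_field (osc_metric lambda) V)
    (V_harm : defines_harmonic_map (osc_metric lambda)
                (canonical_frame lambda) V) :
  minimal_field (osc_metric lambda) V.
Proof.
pose l := lambda (Ordinal hn).
have lambdaE i : lambda i = l by exact: hlambda.
have VE := left_invariantE V_inv.
move: (V 0) VE V_unit V_harm => nu -> {V V_inv} nu1 harm.
move: harm; rewrite canonical_frame_left_mul osc_metricE.
move=> /(harmonic_left_invariant (coframe_frame lambda) (coframe_mx_derive
  lambda)
  (frame_mx_derive lambda) (lc_mx_skew lambda) (osc_torsion lambda)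
  (lc_mx_div lambda)) [[s h1] h2].
move: nu1 h1 h2; rewrite -(osc_pointK nu).
move: (lsubmx nu) (nu 0 (ord_xi n)) (nu 0 (ord_zeta n)) => w a b nu1.
have {}nu1 : rdot w w + a ^+ 2 + b ^+ 2 = 1.
  have := nu1 0; rewrite osc_metricE form_eval_frame.
  rewrite -mulmxA (mulmx1C (coframe_frame lambda 0)) mulmx1 rdot_osc_point.
  by rewrite !expr2.
rewrite (sum_lc_lc lambdaE) osc_pointZ => h1 h2.
have hw : - (2^-1 + l ^+ 2) *: w = s *: w.
  by have := congr1 lsubmx h1; rewrite !lsubmx_osc_point.
have ha : - (n%:R / 2) * a = s * a.
  by have := congr1 (fun v : 'rV_(n + n + 2) => v 0 (ord_xi n)) h1;
    rewrite !osc_point_xi.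
have hb : s * b = 0.
  by have := congr1 (fun v : 'rV_(n + n + 2) => v 0 (ord_zeta n)) h1;
    rewrite !osc_point_zeta.
have n0 : n%:R != 0 :> R by rewrite pnatr_eq0 -lt0n.
(* If [b] is nonzero the eigenvalue [s] is 0, while [- (1/2 + l^2)] and, as [n] is positive, [- n/2]
   are not; hence [nu] is [+-zeta]. *)
rewrite -osc_metricE; have [b0|b0] := eqVneq b 0; last first.
  have s0 : s = 0 by apply/eqP; move/eqP: hb; rewrite mulf_eq0 (negPf b0) orbF.
  have a0 : a = 0.
    apply/eqP; move/eqP: ha;
      rewrite s0 mul0r mulf_eq0 oppr_eq0 mulf_eq0 invr_eq0.
    by rewrite (negPf n0) pnatr_eq0.
  have w0 : w = 0.
    apply/eqP; move/eqP: hw; rewrite s0 scale0r scaler_eq0 oppr_eq0.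
    have : 2^-1 + l ^+ 2 != 0 by apply: lt0r_neq0; have := sqr_ge0 l; lra.
    by move/negPf ->.
  rewrite a0 w0; apply: (minimal_vertical lambdaE); last by rewrite mul0r.
  by rewrite -nu1 w0 a0 rdot0l add0r.
have [a0|a0] := eqVneq a 0.
  rewrite a0 b0; apply: (minimal_horizontal lambdaE).
  by rewrite -nu1 a0 b0 expr2 mul0r !addr0.
(* The first condition alone would allow [a] and [w] both nonzero when [n/2 = 1/2 + l^2]; the
   curvature condition forces [I w = 0], so [nu] is [+-xi]. *)
have w0 : w = 0.
  have /eqP := congr1 lsubmx h2; rewrite b0 (sum_curvature lambdaE) linear0.
  rewrite scaler_eq0 oppr_eq0 !mulf_eq0 (negPf n0) (negPf a0) invr_eq0
    pnatr_eq0 /=.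
  move=> /eqP Iw; have := osc_I_I w; rewrite Iw linear0.
  by move=> /esym/eqP; rewrite oppr_eq0 => /eqP.
rewrite w0 b0; apply: (minimal_vertical lambdaE); last by rewrite mulr0.
by rewrite -nu1 w0 b0 rdot0l add0r.
Qed.
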